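(* Let $d\in\{2,3\}$. For every $\varepsilon>0$ there exists $m_0$ such that every directed graph $D=(V,E)$ with $m\ge m_0$ edges and minimum outdegree at least $d$ admits a bipartition $V=V_1\cup V_2$ of its vertex set for which $$\min\{e(V_1,V_2),e(V_2,V_1)\}\ \ge\ \left(\frac{d-1}{2(2d-1)}-\varepsilon\right)m.$$ Thus the asymptotically optimal constants are $c_2=\frac16$ and $c_3=\frac15$, where $c_d$ denotes the supremum of all real $c$ for which there exists $m_0$ such that every directed graph with $m\ge m_0$ edges and minimum outdegree at least $d$ admits a bipartition $V=V_1\cup V_2$ with $\min\{e(V_1,V_2),e(V_2,V_1)\}\ge c\,m$.
   Context: A directed graph $D=(V,E)$ is a finite vertex set $V$ together with a set $E$ of distinct ordered pairs (edges) $\overrightarrow{uv}$ with $u\ne v$; no loops or multiple edges are allowed, but both $\overrightarrow{uv}$ and $\overrightarrow{vu}$ may be present. The minimum outdegree is the minimum over $v\in V$ of the number of out-neighbors of $v$. For $X,Y\subset V$, $e(X,Y)$ is the number of edges $\overrightarrow{xy}\in E$ with $x\in X$, $y\in Y$. A bipartition $V=V_1\cup V_2$ is a partition of $V$ into two disjoint sets. *)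

(* Defs.v *)
From mathcomp Require Import all_boot all_order all_algebra.
From mathcomp Require Import all_classical all_reals.

Set Implicit Arguments.
Unset Strict Implicit.
Unset Printing Implicit Defensive.

Import Order.TTheory GRing.Theory Num.Theory.
Local Open Scope ring_scope.

Record digraph := Digraph {
  vertex :> finType;
  edges : {set vertex * vertex};
  edges_loopless : forall v : vertex, (v, v) \notin edges
}.

Definition outdeg (D : digraph) (v : D) : nat :=
  #|[set u : D | (v, u) \in edges D]|.

Definition min_outdeg_ge (D : digraph) (d : nat) : Prop :=
  forall v : D, (d <= outdeg v)%N.

Definition edges_between (D : digraph) (X Y : {set D}) : nat :=
  #|[set p in edges D | (p.1 \in X) && (p.2 \in Y)]|.

Definition bipartition (D : digraph) (V1 V2 : {set D}) : Prop :=
  V1 :|: V2 = [set: D] /\ [disjoint V1 & V2].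

Definition admissible_const (R : realType) (d : nat) (c : R) : Prop :=
  exists m0 : nat, forall D : digraph,
    (m0 <= #|edges D|)%N -> min_outdeg_ge D d ->
    exists V1 V2 : {set D}, bipartition V1 V2 /\
      c * #|edges D|%:R
        <= (minn (edges_between V1 V2) (edges_between V2 V1))%:R.

(* [sup] returns 0 on sets that are empty or unbounded above, so an equation
   [opt_const R d = c] with [c] nonzero does say that the supremum exists. *)
Definition opt_const (R : realType) (d : nat) : R :=
  sup [set c : R | admissible_const d c]%classic.

(* Main.v *)
(** Put [s_v = outdeg v - indeg v], let [A] be the set of the boundedly many
    vertices of degree more than [delta m], and let [B] be its complement.
    A bipartition is judicious when its cut is large and [\sum_(V1) s_v] is
    small.  Choose signs on [A] minimising [theta = |\sum_A +- s_v|].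

    Colouring [B] at random, independently in small blocks, the sum of the
    [s_v] over [B] concentrates.  If the blocks are induced stars, coloured so
    that each leaf is opposite its centre, then both directions receive about
    [(m + M - theta) / 4] arcs, [M] being the number of arcs inside stars.

    By minimality, [theta = 0], or some [w] in [A] has a signed contribution at
    most [- theta], or exactly one vertex of [A] contributes positively.  In the
    second case a colouring of [B] with bias 2/5 : 3/5 gives [m / 5].  In the
    third one [theta <= |s_v| - \sum |s_u|], and the outdegree condition gives
    [m - q theta >= - \sum_B need], with [q = 2d - 1] and [need] at most [d - 1];
    an extremal star packing of [B] satisfies [\sum_B need <= q M].

    For the upper bound take disjoint circulant tournaments on [q] vertices, all
    of which send arcs to one hub: the arcs leaving the side of the hub lie in
    the tournaments, up to a bounded number. *)
Require Import Defs.
From mathcomp Require Import all_boot all_order all_algebra.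
From mathcomp Require Import all_classical all_reals.
From mathcomp Require Import zify ring lra.

Set Implicit Arguments.
Unset Strict Implicit.
Unset Printing Implicit Defensive.

Import Order.TTheory GRing.Theory Num.Theory.
Local Open Scope ring_scope.

(** * Rounding fractional partitions *)

Definition upd (T : finType) (S : Type) (x : {ffun T -> S}) v t : {ffun T -> S} :=
  [ffun w => if w == v then t else x w].

Section Rounding.
Variables (R : realFieldType) (T : finType).
Implicit Types (x mu tau : {ffun T -> R}) (F : {ffun T -> R} -> R).

(** Interpolation between 0 and 1 is asked for every [t], so that it also covers the colour -1. *)
Definition multiaffine F := forall x v t,
  F (upd x v t) = (1 - t) * F (upd x v 0) + t * F (upd x v 1).

Lemma multiaffine_sum (I : finType) (F : I -> {ffun T -> R} -> R) :
  (forall i, multiaffine (F i)) -> multiaffine (fun x => \sum_i F i x).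
Proof.
move=> aF x v t; rewrite !mulr_sumr -big_split /=.
by apply: eq_bigr => i _; apply: aF.
Qed.

Lemma multiaffine_bilinear (a b c d : R) (u w : T) : u != w ->
  multiaffine (fun x => a + b * x u + c * x w + d * (x u * x w)).
Proof.
move=> uw x v t; rewrite !ffunE.
by case: (u =P v) uw => [->|_] uw; case: (w =P v) uw => [->|_] uw;
  rewrite ?eqxx // in uw *; ring.
Qed.

Lemma multiaffine_linear (a b : R) (u : T) :
  multiaffine (fun x => a + b * x u).
Proof. by move=> x v t; rewrite !ffunE; case: (u =P v) => _; ring. Qed.

Lemma eq_multiaffine F G : F =1 G -> multiaffine F -> multiaffine G.
Proof. by move=> FG aF x v t; rewrite -!FG. Qed.

(** Coordinates are rounded one at a time, since an affine function on [-1, 1] is largest at an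
    endpoint. [F mu] is the expectation of [F] under independent signs of means [mu], so this stands
    in for the probabilistic method. *)
Lemma multiaffine_round F mu : multiaffine F -> (forall v, `|mu v| <= 1) ->
  exists2 tau : {ffun T -> R}, (forall v, tau v = 1 \/ tau v = -1) & F mu <= F tau.
Proof.
move=> aF mu1.
suff [tau [_ tauE Fle]] : exists tau : {ffun T -> R},
    [/\ forall v, `|tau v| <= 1, forall v, v \in enum T -> tau v = 1 \/ tau v = -1
      & F mu <= F tau].
  by exists tau => // v; apply: tauE; rewrite mem_enum.
elim: (enum T) => [|v r [tau [tau1 taur Fle]]]; first by exists mu; split.
have updle t : t = 1 \/ t = -1 ->
    (forall w, `|upd tau v t w| <= 1) /\
    (forall w, w \in v :: r -> upd tau v t w = 1 \/ upd tau v t w = -1).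
  move=> t1; split=> w; rewrite ffunE.
    by case: (w =P v) => // _; case: t1 => ->; rewrite ?normrN normr1.
  by rewrite inE; case: (w =P v) => //= _ /taur.
have tauE : upd tau v (tau v) = tau.
  by apply/ffunP => w; rewrite ffunE; case: (w =P v) => [->|].
have Ftau := aF tau v (tau v); rewrite tauE in Ftau.
have FN := aF tau v (-1).
have /andP[tN tP] : -1 <= tau v <= 1 by rewrite -ler_norml.
have [h|h] := leP (F (upd tau v 0)) (F (upd tau v 1)).
- have [u1 u2] := updle 1 (or_introl erefl).
  exists (upd tau v 1); split=> //; apply: (le_trans Fle); rewrite Ftau; nra.
- have [u1 u2] := updle (-1) (or_intror erefl).
  exists (upd tau v (-1)); split=> //; apply: (le_trans Fle); rewrite Ftau FN; nra.
Qed.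

End Rounding.

(** * Simultaneous control of the cut and the imbalance *)

Section Judicious.
Variables (R : realFieldType) (T : finType) (e : T -> T -> R).
Hypothesis e_ge0 : forall u w, 0 <= e u w.

Definition wsize : R := \sum_u \sum_w e u w.
Definition excess (v : T) : R := \sum_w e v w - \sum_w e w v.
Definition wcross (V : pred T) : R := \sum_u \sum_w e u w * (V u && ~~ V w)%:R.

(* Vertex [v] gets the colour [k v * x (rep v)]: there is one independent
   variable per block, of mean [mu]. *)
Variables (rep : T -> T) (k mu : T -> R).
Hypothesis k1 : forall v, k v = 1 \/ k v = -1.
Hypothesis mu1 : forall v, `|mu v| <= 1.

(** Expected product of two colours. Inside a block the squared variable is replaced by 1, which
    keeps the expression multiaffine. *)
Definition corr (x : T -> R) (u w : T) : R :=
  if rep u == rep w then k u * k w else k u * k w * (x (rep u) * x (rep w)).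
Definition ecut (x : T -> R) : R := \sum_u \sum_w e u w * (1 - corr x u w) / 2.
Definition edisc (x : T -> R) : R := \sum_v excess v * (k v * x (rep v)).
Definition bexcess (r : T) : R := \sum_(v | rep v == r) excess v * k v.

Lemma edisc_blocks x : edisc x = \sum_r bexcess r * x r.
Proof.
rewrite /edisc (partition_big rep predT) //=; apply: eq_bigr => r _.
by rewrite /bexcess mulr_suml; apply: eq_bigr => v /eqP <-; rewrite mulrA.
Qed.

Lemma sum_excess (f : T -> R) :
  \sum_v excess v * f v = \sum_u \sum_w e u w * (f u - f w).
Proof.
rewrite /excess; under eq_bigr do rewrite mulrBl !mulr_suml.
rewrite sumrB [X in _ - X]exchange_big /= -sumrB; apply: eq_bigr => u _.
by rewrite -sumrB; apply: eq_bigr => w _; rewrite mulrBr.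
Qed.

(* Round [cut - lam * (disc - disc mu)^2], made multiaffine by [x r ^+ 2 = 1]:
   this controls the cut and the imbalance simultaneously. *)
Lemma judicious_round (eta : R) : 0 < eta <= 1 -> 0 < wsize ->
  \sum_r bexcess r ^+ 2 * (1 - mu r ^+ 2) <= eta ^+ 3 / 2 * wsize ^+ 2 ->
  exists V : pred T,
    (ecut mu + edisc mu / 2) / 2 - eta * wsize <= wcross V /\
    (ecut mu - edisc mu / 2) / 2 - eta * wsize <= wcross (predC V).
Proof.
set m := wsize => /andP[eta0 eta1] m0 hvar.
(* With this weight the variance costs at most [eta * m], and since cuts lie between 0 and [m], the
   imbalance is forced to within [eta * m] of its mean. *)
pose lam := 2 / (eta ^+ 2 * m).
have lam0 : 0 < lam by rewrite divr_gt0 ?mulr_gt0 ?exprn_gt0 //.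
pose cv (x : {ffun T -> R}) r r' := if r == r' then 1 - 2 * mu r * x r + mu r ^+ 2
  else (x r - mu r) * (x r' - mu r').
pose Q (x : {ffun T -> R}) := \sum_r \sum_r' bexcess r * bexcess r' * cv x r r'.
pose Phi (x : {ffun T -> R}) := \sum_u \sum_w (e u w * (1 - corr x u w) / 2)
   + \sum_r \sum_r' (- lam * (bexcess r * bexcess r' * cv x r r')).
have PhiE x : Phi x = ecut x - lam * Q x.
  rewrite /Phi /Q mulr_sumr -sumrN; congr (_ + _); apply: eq_bigr => r _.
  by rewrite mulr_sumr -sumrN; apply: eq_bigr => r' _; ring.
have aPhi : multiaffine Phi.
  have a1 : multiaffine (fun x : {ffun T -> R} =>
      \sum_u \sum_w (e u w * (1 - corr x u w) / 2)).
    apply: multiaffine_sum => u; apply: multiaffine_sum => w.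
    have [ruw|ruw] := boolP (rep u == rep w).
      apply: (@eq_multiaffine _ _ (fun x => e u w * (1 - k u * k w) / 2 + 0 * x u));
        last exact: multiaffine_linear.
      by move=> x /=; rewrite /corr ruw; ring.
    apply: (@eq_multiaffine _ _ (fun x => e u w / 2 + 0 * x (rep u) + 0 * x (rep w)
       + (- (e u w * (k u * k w) / 2)) * (x (rep u) * x (rep w))));
      last exact: multiaffine_bilinear.
    by move=> x /=; rewrite /corr (negbTE ruw); field.
  have a2 : multiaffine (fun x : {ffun T -> R} =>
      \sum_r \sum_r' (- lam * (bexcess r * bexcess r' * cv x r r'))).
    apply: multiaffine_sum => r; apply: multiaffine_sum => r'; rewrite /cv.
    have [_|ruw] := boolP (r == r').
      apply: (@eq_multiaffine _ _ (fun x => - lam * (bexcess r * bexcess r' *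
        (1 + mu r ^+ 2)) + (2 * lam * bexcess r * bexcess r' * mu r) * x r));
        last exact: multiaffine_linear.
      by move=> x /=; ring.
    pose c := - lam * bexcess r * bexcess r'.
    apply: (@eq_multiaffine _ _ (fun x => c * mu r * mu r' + (- c * mu r') * x r
       + (- c * mu r) * x r' + c * (x r * x r')));
      last exact: multiaffine_bilinear.
    by move=> x /=; rewrite /c; ring.
  by move=> x v t; rewrite /Phi a1 a2; ring.
pose mu' : {ffun T -> R} := [ffun v => mu v].
have [|tau tau1 Phile] := multiaffine_round aPhi (mu := mu').
  by move=> v; rewrite ffunE.
have tausq v : tau v * tau v = 1 by case: (tau1 v) => ->; ring.
have ksq v : k v * k v = 1 by case: (k1 v) => ->; ring.
(* At the mean the off-diagonal terms vanish and the diagonal ones are variances of signs. *)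
have Qmu : Q mu' = \sum_r bexcess r ^+ 2 * (1 - mu r ^+ 2).
  apply: eq_bigr => r _; rewrite (bigD1 r) //= big1 ?addr0 => [|r' r'r].
    by rewrite /cv eqxx ffunE; ring.
  by rewrite /cv eq_sym (negbTE r'r) !ffunE; ring.
have Qtau : Q tau = (edisc tau - edisc mu) ^+ 2.
  rewrite !edisc_blocks -sumrB expr2 mulr_suml; apply: eq_bigr => r _.
  rewrite mulr_sumr; apply: eq_bigr => r' _; rewrite /cv.
  case: eqP => [<-|_]; last by ring.
  by have := tausq r; move: (tau r) (mu r) (bexcess r) => t y b h; ring: h.
have cmu : ecut mu' = ecut mu.
  apply: eq_bigr => u _; apply: eq_bigr => w _.
  by rewrite /corr !ffunE.
rewrite !PhiE cmu Qmu Qtau in Phile.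
pose s v := k v * tau (rep v).
have s1 v : s v = 1 \/ s v = -1.
  by rewrite /s; case: (k1 v) => ->; case: (tau1 (rep v)) => ->;
    rewrite ?mul1r ?mulN1r ?opprK; [left|right|right|left].
pose V : pred T := fun v => s v == 1.
have VE v : s v = (V v)%:R *+ 2 - 1.
  have n1 : (-1 == 1 :> R) = false by apply/negbTE/eqP; lra.
  by rewrite /V; case: (s1 v) => ->; rewrite ?eqxx ?n1 /=; ring.
have corrE u w : corr tau u w = s u * s w.
  rewrite /corr /s; case: eqP => [->|_]; last by ring.
  by have := tausq (rep w); move: (tau (rep w)) (k u) (k w) => t a b h; ring: h.
(* The cut is the sum of the two one-way cuts and the imbalance twice their difference, so together
   they determine both. *)
have cutV : ecut tau = wcross V + wcross (predC V).
  rewrite -big_split; apply: eq_bigr => u _; rewrite -big_split.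
  apply: eq_bigr => w _; rewrite corrE !VE /=.
  by case: (V u); case: (V w) => /=; field.
have discV : edisc tau = 2 * (wcross V - wcross (predC V)).
  rewrite /edisc (sum_excess s) /wcross -sumrB mulr_sumr; apply: eq_bigr => u _.
  rewrite -sumrB mulr_sumr; apply: eq_bigr => w _; rewrite !VE /=.
  by case: (V u); case: (V w) => /=; ring.
have cutm : ecut tau <= m.
  rewrite cutV -big_split; apply: ler_sum => u _; rewrite -big_split.
  apply: ler_sum => w _; rewrite /= -mulrDr ler_piMr //=.
  by case: (V u); case: (V w) => /=; rewrite ?addr0 ?add0r.
have cut0 : 0 <= ecut mu.
  apply: sumr_ge0 => u _; apply: sumr_ge0 => w _.
  rewrite mulr_ge0 ?invr_ge0 // mulr_ge0 // subr_ge0.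
  rewrite -[leRHS]normr1 (le_trans (ler_norm _)) // normr1.
  have kn v : `|k v| = 1 by case: (k1 v) => ->; rewrite ?normrN normr1.
  rewrite /corr; case: eqP => _; rewrite !normrM !kn ?mul1r //.
  by rewrite -[1]mulr1 ler_pM.
set X := edisc tau - edisc mu in Phile *.
have lamvar : lam * \sum_r bexcess r ^+ 2 * (1 - mu r ^+ 2) <= eta * m.
  apply: (le_trans (ler_wpM2l (ltW lam0) hvar)).
  rewrite /lam le_eqVlt; apply/orP; left; apply/eqP.
  by field; rewrite !gt_eqF.
have cutlow : ecut mu - eta * m <= ecut tau.
  have lX0 : 0 <= lam * X ^+ 2 by rewrite mulr_ge0 ?sqr_ge0 ?ltW.
  by lra.
have Xsq : X ^+ 2 <= (eta * m) ^+ 2.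
  have h : lam * X ^+ 2 <= 2 * m.
    have em : eta * m <= m by rewrite ler_piMl ?(ltW m0).
    by lra.
  have : X ^+ 2 = (lam * X ^+ 2) * (eta ^+ 2 * m / 2).
    by rewrite /lam; field; rewrite !gt_eqF.
  move=> ->; have -> : (eta * m) ^+ 2 = (2 * m) * (eta ^+ 2 * m / 2) by field.
  by apply: ler_wpM2r => //; rewrite divr_ge0 // mulr_ge0 ?sqr_ge0 ?(ltW m0).
have Xn : `|X| <= eta * m.
  by rewrite -(@ler_pXn2r _ 2) ?nnegrE ?normr_ge0 ?real_normK ?num_real // mulr_ge0 ?ltW.
have /andP[XN XP] : - (eta * m) <= X <= eta * m by rewrite -ler_norml.
have em0 : 0 < eta * m by rewrite mulr_gt0.
exists V; rewrite /X discV in XN XP; rewrite cutV in cutlow; split; lra.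
Qed.

End Judicious.

(** * Packing induced stars *)

Section Stars.
Variables (T : finType) (E : rel T).
Hypothesis E_irr : irreflexive E.

Definition mult (u v : T) : nat := E u v + E v u.

(* [rep] sends each vertex to the centre of its star; stars are induced. *)
Definition star_rep (rep : T -> T) : Prop :=
  [/\ forall v, rep (rep v) = rep v,
      forall v, rep v != v -> (0 < mult v (rep v))%N
    & forall u v, rep u = rep v -> rep u != u -> rep v != v -> mult u v = 0%N].

Definition single (rep : T -> T) (x : T) := [forall v, (rep v == x) == (v == x)].

Lemma singleP rep x : reflect (forall v, (rep v == x) = (v == x)) (single rep x).
Proof. by apply: (iffP forallP) => h v; [exact: (eqP (h v)) | apply/eqP/h]. Qed.

(* The term [#|_| <= 2] is a tie-breaker, used only in [triangle_surplus]: it is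
   worse to leave a vertex of degree at most 2 alone. *)
Definition penalty (x : T) : nat := 4 + (#|[pred y | 0 < mult x y]| <= 2)%N.

(** Covering a lone vertex gains at least 2 + 4, more than the 4 lost with a double arc. Hence a
    move that covers one more vertex pays even at the price of such an arc. *)
Definition local_score (rep : T -> T) (v : T) : int :=
  (2 * mult v (rep v))%N%:Z - (if single rep v then penalty v else 0%N)%:Z.

Definition score (rep : T -> T) : int := \sum_v local_score rep v.

Lemma multC u v : mult u v = mult v u.
Proof. by rewrite /mult addnC. Qed.

Lemma multvv v : mult v v = 0%N.
Proof. by rewrite /mult E_irr. Qed.

Lemma mult_le2 u v : (mult u v <= 2)%N.
Proof. by rewrite /mult; do 2!case: (E _ _). Qed.

Lemma penalty_bounds x : (4 <= penalty x <= 5)%N.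
Proof. by rewrite /penalty; case: (#|_| <= 2)%N. Qed.

(** The basic move. Its last hypothesis keeps the star of [y] induced. *)
Lemma attach (rep : {ffun T -> T}) x y :
  star_rep rep -> single rep x -> rep y = y -> y != x -> (0 < mult x y)%N ->
  (forall v, rep v = y -> v != y -> mult x v = 0%N) ->
  star_rep (upd rep x y) /\
  score (upd rep x y) = score rep + (2 * mult x y)%N%:Z + (penalty x)%:Z
     + (if single rep y then penalty y else 0%N)%:Z.
Proof.
move=> [rr radj rind] /singleP sx ry yx xy xind.
have rx : rep x = x by apply/eqP; rewrite sx.
split.
  split=> [v|v|u v]; rewrite !ffunE.
  - case: (v =P x) => [_|/eqP vx]; first by rewrite (negbTE yx).
    by rewrite sx (negbTE vx) rr.
  - by case: (v =P x) => [->|/eqP vx] // /radj.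
  - case: (u =P x) => [->|/eqP ux]; case: (v =P x) => [->|/eqP vx].
    + by rewrite multvv.
    + by move=> yr _ vr; apply: xind => //; apply: contra_neq vr => ->.
    + by move=> yr ur _; rewrite multC; apply: xind => //; apply: contra_neq ur => ->.
    + exact: rind.
have sx' : single (upd rep x y) x = false.
  by apply/negbTE/negP => /singleP/(_ x); rewrite ffunE eqxx (negbTE yx).
have sy' : single (upd rep x y) y = false.
  by apply/negbTE/negP => /singleP/(_ x); rewrite ffunE !eqxx eq_sym (negbTE yx).
have s_other z : z != x -> z != y -> single (upd rep x y) z = single rep z.
  move=> zx zy; apply: eq_forallb => v; rewrite ffunE.
  case: (v =P x) => [->|//].
  by rewrite rx ![_ == z]eq_sym (negbTE zy) (negbTE zx).
rewrite /score (bigD1 x) //= (bigD1 y) //= [in RHS](bigD1 x) //= [in RHS](bigD1 y) //=.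
rewrite (eq_bigr (local_score rep)) => [|z /andP[zx zy]]; last first.
  by rewrite /local_score s_other // ffunE (negbTE zx).
rewrite /local_score sx' sy' !ffunE eqxx (negbTE yx) ry rx !multvv.
have -> : single rep x by apply/singleP.
by lia.
Qed.

Lemma detach (rep : {ffun T -> T}) u :
  star_rep rep -> rep u != u ->
  [/\ star_rep (upd rep u u), single (upd rep u u) u
    & score (upd rep u u) = score rep - (2 * mult u (rep u))%N%:Z - (penalty u)%:Z
     - (if single (upd rep u u) (rep u) then penalty (rep u) else 0%N)%:Z].
Proof.
move=> [rr radj rind] ru.
have not_ru v : rep v != u by apply: contra_neq ru => <-; rewrite rr.
have val : star_rep (upd rep u u).
  split=> [v|v|v w]; rewrite !ffunE.
  - case: (v =P u) => [_|vu]; first by rewrite eqxx.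
    by rewrite (negbTE (not_ru v)) rr.
  - by case: (v =P u) => [->|vu]; [rewrite eqxx | apply: radj].
  - case: (v =P u) => [->|vu]; first by rewrite eqxx.
    by case: (w =P u) => [->|wu]; [rewrite eqxx | apply: rind].
have su : single (upd rep u u) u.
  apply/singleP => v; rewrite ffunE; case: (v =P u) => [_|/eqP vu].
    by rewrite eqxx.
  by rewrite (negbTE (not_ru v)).
split=> //.
(* Reattaching [u] restores [rep], so the score changes as in [attach], reversed. *)
have := attach (y := rep u) val su; rewrite ffunE (negbTE ru) rr => /(_ erefl isT (radj u ru)).
have -> : upd (upd rep u u) u (rep u) = rep.
  by apply/ffunP => v; rewrite !ffunE; case: (v =P u) => [->|].
case=> [v|_ ->]; last by lia.
rewrite ffunE; case: (v =P u) => [-> h|vu vr vru]; first by rewrite -h multvv.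
by apply: rind => //; rewrite vr eq_sym.
Qed.

Lemma single_rep rep x : single rep x -> rep x = x.
Proof. by move=> /singleP/(_ x); rewrite eqxx => /eqP. Qed.

(** * Exchange arguments at a lone vertex *)

Section Optimal.
Variable rep : {ffun T -> T}.
Hypothesis rep_star : star_rep rep.
Hypothesis rep_max : forall r : {ffun T -> T}, star_rep r -> score r <= score rep.

(** Otherwise [u] could leave its star, which still has the leaf [v], and pair up with [x]: at most
    4 is lost and at least 6 gained. *)
Lemma star_leaf_nadj x u v : single rep x -> rep u != u -> rep v != v ->
  rep v = rep u -> v != u -> mult x u = 0%N.
Proof.
move=> sx ru rv rvu vu.
apply/eqP; rewrite -leqn0 leqNgt; apply/negP => xu.
have ux : u != x by apply: contra_neq ru => ->; apply: single_rep.
have [r1 s1 sc1] := detach rep_star ru.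
have [rr _ _] := rep_star.
have nsc : single (upd rep u u) (rep u) = false.
  apply/negbTE/negP => /singleP/(_ v); rewrite ffunE (negbTE vu) rvu eqxx.
  by rewrite -rvu eq_sym (negbTE rv).
have sx1 : single (upd rep u u) x.
  apply/singleP => w; rewrite ffunE; case: (w =P u) => [->|_]; first by [].
  by rewrite (singleP _ _ sx).
have [| |r2 sc2] := attach r1 sx1 _ ux xu.
- by rewrite ffunE eqxx.
- by move=> w /eqP; rewrite (singleP _ _ s1) => ->.
have := rep_max r2; rewrite sc2 sc1 nsc s1.
by have := penalty_bounds x; have := mult_le2 u (rep u); lia.
Qed.

Definition pair_block c l := l != c /\ forall v, (rep v == c) = (v == c) || (v == l).

(** By optimality [x] cannot join the star of [c], so it is adjacent to one of its leaves; by
    [star_leaf_nadj] that leaf is the only one. *)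
Lemma single_adj_center x c : single rep x -> rep c = c -> (0 < mult x c)%N ->
  exists2 l, pair_block c l & (0 < mult x l)%N.
Proof.
move=> sx rc xc; have [rr radj rind] := rep_star.
have cx : c != x by apply: contraTneq xc => ->; rewrite multvv.
have [/existsP[l /and3P[/eqP rl lc xl]]|/existsPn nol] :=
    boolP [exists l, [&& rep l == c, l != c & 0 < mult x l]%N].
  exists l => //; split=> // v; apply/idP/idP => [/eqP rv|].
    apply: contraTT xl => /norP[vc vl]; rewrite -leqNgt leqn0; apply/eqP.
    by apply: (@star_leaf_nadj x l v) => //; rewrite ?rv ?rl // eq_sym.
  by case/orP => /eqP ->; rewrite ?rc ?rl.
have [|r sc] := attach rep_star sx rc cx xc.
  move=> v rv vc; apply/eqP; rewrite -leqn0 leqNgt.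
  by have := nol v; rewrite rv eqxx vc.
have := rep_max r; rewrite sc.
by have := penalty_bounds x; lia.
Qed.

Lemma single_detach x u : single rep x -> single (upd rep u u) x.
Proof.
move=> sx; apply/singleP => w; rewrite ffunE; case: (w =P u) => [->|_] //.
by rewrite (singleP _ _ sx).
Qed.

Lemma pair_center c l : pair_block c l -> rep c = c.
Proof. by case=> _ /(_ c); rewrite eqxx => /eqP. Qed.

Lemma pair_leaf c l : pair_block c l -> rep l = c.
Proof. by case=> _ /(_ l); rewrite eqxx orbT => /eqP. Qed.

Lemma detach_pair c l : pair_block c l ->
  [/\ star_rep (upd rep l l), single (upd rep l l) l, single (upd rep l l) c
    & score (upd rep l l) =
      score rep - (2 * mult l c)%N%:Z - (penalty l)%:Z - (penalty c)%:Z].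
Proof.
move=> cl; have rl := pair_leaf cl; have [lc blk] := cl.
have [|r1 s1 sc1] := @detach rep l rep_star; first by rewrite rl eq_sym.
have s1c : single (upd rep l l) c.
  apply/singleP => w; rewrite ffunE; case: (w =P l) => [->|/eqP wl] //.
  by rewrite blk (negbTE wl) orbF.
by split=> //; rewrite sc1 rl s1c.
Qed.

(** Putting [x] in the place of [l] leaves [l] alone instead of [x], and cannot improve the
    score. *)
Lemma pair_swap_leaf x c l : pair_block c l -> single rep x -> (0 < mult x c)%N ->
  (2 * mult x c + penalty x <= 2 * mult l c + penalty l)%N.
Proof.
move=> cl sx xc; have [r1 sl sc sc1] := detach_pair cl.
have cx : c != x by apply: contraTneq xc => ->; rewrite multvv.
have [v|r2 sc2] := attach r1 (single_detach l sx) (single_rep sc) cx xc.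
  by move=> /eqP; rewrite (singleP _ _ sc) => ->.
by have := rep_max r2; rewrite sc2 sc1 sc; lia.
Qed.

Lemma pair_swap_center x c l : pair_block c l -> single rep x -> (0 < mult x l)%N ->
  (2 * mult x l + penalty x <= 2 * mult l c + penalty c)%N.
Proof.
move=> cl sx xl; have [r1 sl sc sc1] := detach_pair cl.
have lx : l != x by apply: contraTneq xl => ->; rewrite multvv.
have [v|r2 sc2] := attach r1 (single_detach l sx) (single_rep sl) lx xl.
  by move=> /eqP; rewrite (singleP _ _ sl) => ->.
by have := rep_max r2; rewrite sc2 sc1 sl; lia.
Qed.

(** Two distinct lone vertices could split the pair into [x] with [c] and [x'] with [l], which
    covers both. *)
Lemma pair_private x x' c l : pair_block c l -> single rep x -> single rep x' ->
  (0 < mult x c)%N -> (0 < mult x' l)%N -> x = x'.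
Proof.
move=> cl sx sx' xc xl; apply/eqP; apply/negPn/negP => xx.
have [r1 sl sc sc1] := detach_pair cl.
have cx : c != x by apply: contraTneq xc => ->; rewrite multvv.
have lx' : l != x' by apply: contraTneq xl => ->; rewrite multvv.
have [lc _] := cl.
have cx' : c != x'.
  apply: contraTneq lc => cE; rewrite negbK.
  by have := singleP _ _ sx' l; rewrite (pair_leaf cl) cE eqxx => /esym/eqP ->.
have lx : l != x.
  apply: contra_neq cx => lE.
  by rewrite -(pair_leaf cl) lE; exact: single_rep.
have [v|r2 sc2] := attach r1 (single_detach l sx) (single_rep sc) cx xc.
  by move=> /eqP; rewrite (singleP _ _ sc) => ->.
have s2 : single (upd (upd rep l l) x c) x'.
  apply/singleP => w; rewrite ffunE; case: (w =P x) => [->|_].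
    by rewrite (negbTE cx') (negbTE xx).
  exact/singleP/single_detach.
have s2l : single (upd (upd rep l l) x c) l.
  apply/singleP => w; rewrite ffunE; case: (w =P x) => [->|_].
    by rewrite ![_ == l]eq_sym (negbTE lc) (negbTE lx).
  exact/singleP.
have [v|r3 sc3] := attach r2 s2 (single_rep s2l) lx' xl.
  by move=> /eqP; rewrite (singleP _ _ s2l) => ->.
have := rep_max r3; rewrite sc3 sc2 sc1 sc s2l.
by have := penalty_bounds x; have := penalty_bounds x'; have := mult_le2 l c; lia.
Qed.

End Optimal.

(** If [y] is a leaf, it is the only one of its star by [star_leaf_nadj]. Exchanging centre and leaf
    gives a packing of the same score in which [y] is a centre, so [single_adj_center] applies to
    it. *)
Lemma single_adj_pair (rep : {ffun T -> T}) x y :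
  star_rep rep -> (forall r : {ffun T -> T}, star_rep r -> score r <= score rep) ->
  single rep x -> (0 < mult x y)%N ->
  exists l, [/\ pair_block rep (rep y) l, (0 < mult x (rep y))%N & (0 < mult x l)%N].
Proof.
move=> rs rmax sx xy; have [rr radj rind] := rs.
have [ry|ry] := eqVneq (rep y) y.
  have [l pl xl] := single_adj_center rs rmax sx ry xy.
  by exists l; rewrite ry.
have cy : pair_block rep (rep y) y.
  split; first by rewrite eq_sym.
  move=> v; apply/idP/idP => [/eqP rv|/orP[] /eqP ->]; last 2 first.
  - by rewrite rr.
  - by [].
  apply: contraTT xy => /norP[vc vy]; rewrite -leqNgt leqn0; apply/eqP.
  by apply: (star_leaf_nadj rs rmax sx ry (v := v)) => //; rewrite rv // eq_sym.
have [r1 sy sc sc1] := detach_pair rs cy.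
have cx : rep y != x.
  apply: contra_neq ry => rE.
  by have := singleP _ _ sx y; rewrite rE eqxx => /esym/eqP ->.
have yc : y != rep y by rewrite eq_sym.
have [|v|r2 sc2] := attach r1 sc (single_rep sy) yc.
- by rewrite multC; apply: radj.
- by move=> /eqP; rewrite (singleP _ _ sy) => ->.
set rep2 := upd _ _ _ in r2 sc2.
have sE : score rep2 = score rep.
  by rewrite sc2 sc1 sy (multC (rep y)); lia.
have yx : y != x by apply: contraTneq xy => ->; rewrite multvv.
have s2 : single rep2 x.
  apply/singleP => w; rewrite ffunE; case: (w =P rep y) => [->|_].
    by rewrite (negbTE yx) (negbTE cx).
  exact/singleP/single_detach.
have ry2 : rep2 y = y by rewrite !ffunE (negbTE yc) eqxx.
have [|l [ly pl] xl] := single_adj_center r2 _ s2 ry2 xy; first by rewrite sE.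
have cl : rep y = l.
  by have := pl (rep y); rewrite !ffunE !eqxx (negbTE ry) /= => /esym/eqP.
by exists y; split=> //; rewrite cl.
Qed.

(** * Charging the needs of lone vertices to adjacent stars *)

Section Charging.
Variables (R : realFieldType) (rep : {ffun T -> T}) (D : nat) (need : T -> R).
Hypothesis rep_star : star_rep rep.
Hypothesis rep_max : forall r : {ffun T -> T}, star_rep r -> score r <= score rep.
Hypothesis D12 : (0 < D <= 2)%N.
Let o w := #|[pred u | E w u]|.
Hypothesis needP : forall w, [\/ need w <= 0, need w <= 1 /\ (0 < o w)%N
  | [/\ D = 2%N, need w <= 2 & o w = 2%N]].

Let surplus c := \sum_(w | rep w == c)
   ((2 * D + 1)%:R * (mult w (rep w))%:R - need w).

Let need_le w : need w <= D%:R.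
Proof.
case: (needP w) => [h|[h _]|[-> h _]] //; apply: (le_trans h) => //.
by rewrite (ler_nat _ 1); case/andP: D12.
Qed.

Let surplus_noncenter c : rep c != c -> surplus c = 0.
Proof.
move=> rc; apply: big1 => w /eqP rw; have [rr _ _] := rep_star.
by rewrite -rw rr eqxx in rc.
Qed.

Let surplus_single c : single rep c -> surplus c = - need c.
Proof.
move=> sc; rewrite /surplus (bigD1 c) /=; last by rewrite (singleP _ _ sc).
rewrite (single_rep sc) multvv big1 => [|w]; first by rewrite mulr0 sub0r addr0.
by rewrite (singleP _ _ sc) => /andP[->].
Qed.

(** A leaf brings at least 2D + 1 and takes at most D; the centre takes at most D. *)
Let surplus_center c : rep c = c -> ~~ single rep c -> 1 <= surplus c.
Proof.
move=> rc sc; have [rr radj _] := rep_star.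
have [l rl lc] : exists2 l, rep l = c & l != c.
  case/forallPn: sc => l; case: (l =P c) => [->|/eqP lc]; first by rewrite rc eqxx.
  by rewrite eqbF_neg negbK => /eqP rl; exists l.
have leaf w : rep w = c -> w != c ->
    (D + 1)%:R <= (2 * D + 1)%:R * (mult w (rep w))%:R - need w.
  move=> rw wc; have : (0 < mult w (rep w))%N by apply: radj; rewrite rw eq_sym.
  have := need_le w; move: (mult _ _) => k hn.
  rewrite -(ler_nat R) !natrD => k1.
  by have D0 : 0 <= D%:R :> R by []; nra.
rewrite /surplus (bigD1 c) ?rc //= (bigD1 l) ?rl ?eqxx //= multvv mulr0 sub0r.
have := need_le c; have := leaf l rl lc; rewrite rl natrD => hl hc.
have : 0 <= \sum_(i | (rep i == c) && (i != c) && (i != l))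
    ((2 * D + 1)%:R * (mult i (rep i))%:R - need i).
  apply: sumr_ge0 => w /andP[/andP[/eqP rw wc] _].
  by apply: le_trans (leaf w rw wc).
rewrite natrD; set A := \sum_(i | _) _ => hA; lra.
Qed.

Let surplus_pair c l : pair_block rep c l ->
  surplus c = (2 * D + 1)%:R * (mult l c)%:R - need l - need c.
Proof.
move=> cl; have [lc blk] := cl.
rewrite /surplus (bigD1 c) ?blk ?eqxx //= (bigD1 l) ?blk ?eqxx ?orbT //=.
rewrite (pair_center cl) (pair_leaf cl) multvv big1 => [|w].
  by ring.
by rewrite blk -andbA => /andP[/orP[] /eqP ->]; rewrite eqxx ?andbF.
Qed.

(** The stars that pay for a lone [x]. Testing adjacency at the centre loses nothing: by
    [single_adj_pair], a lone vertex adjacent to any vertex of a star is adjacent to its centre. *)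
Let satellite x c := [&& rep c == c, ~~ single rep c & (0 < mult x c)%N].

Let pair_satellite x c l : pair_block rep c l -> (0 < mult x c)%N -> satellite x c.
Proof.
move=> cl xc; rewrite /satellite (pair_center cl) eqxx xc andbT /=.
apply/negP => sc; have [lc _] := cl.
by have := singleP _ _ sc l; rewrite (pair_leaf cl) (negbTE lc) eqxx.
Qed.

Let card_subset2 (P : pred T) a b : (forall y, P y -> y = a \/ y = b) -> (#|P| <= 2)%N.
Proof.
move=> Pab; apply: (@leq_trans #|[set a; b]|); last by rewrite cards2; case: (a != b).
apply: subset_leq_card; apply/fintype.subsetP => y /Pab yab.
by rewrite !inE; case: yab => ->; rewrite eqxx ?orbT.
Qed.

Let card2_subset (P : pred T) a b : (forall y, P y -> y = a \/ y = b) ->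
  #|P| = 2%N -> P a /\ P b.
Proof.
move=> Pab P2.
have sub : P \subset [set a; b].
  apply/fintype.subsetP => y /Pab yab.
  by rewrite !inE; case: yab => ->; rewrite eqxx ?orbT.
have eqc : #|P| = #|[set a; b]|.
  by apply/eqP; rewrite eqn_leq subset_leq_card // P2 cards2; case: (a != b).
have PE := subset_cardP eqc sub.
by split; rewrite -[P _]/(_ \in P) PE !inE eqxx ?orbT.
Qed.

(* The extremal case: [x], [c], [l] span a triangle, every vertex of which needs
   2; comparing with the packings that leave [c] or [l] alone shows that all
   three have no neighbours outside, so [l] cannot have outdegree 2. *)
Let triangle_surplus x c l : single rep x -> pair_block rep c l ->
  (0 < mult x c)%N -> (0 < mult x l)%N -> D = 2%N -> o x = 2%N ->
  (forall y, (0 < mult x y)%N -> y = c \/ y = l) -> 2 <= surplus c.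
Proof.
move=> sx cl xc xl D2 ox Nx; rewrite (surplus_pair cl) D2.
have lc0 : (0 < mult l c)%N.
  have [_ radj _] := rep_star; rewrite -(pair_leaf cl); apply: radj.
  by rewrite (pair_leaf cl) eq_sym; case: cl.
have nl := need_le l; have nc := need_le c; rewrite D2 in nl nc.
have [lc2|lc1] := leqP 2 (mult l c).
  by move: lc2; rewrite -(ler_nat R) => lc2; lra.
have {lc0 lc1} lc1 : mult l c = 1%N by lia.
rewrite lc1.
case: (needP l) => [h|[h _]|[_ _ ol]]; [lra|lra|].
case: (needP c) => [h|[h _]|[_ _ oc]]; [lra|lra|].
have px : penalty x = 5%N by rewrite /penalty (card_subset2 Nx).
have xcl : forall y, E x y -> y = c \/ y = l.
  by move=> y xy; apply: Nx; rewrite /mult xy.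
have [Exc Exl] := card2_subset xcl ox.
have d1 := pair_swap_leaf rep_star rep_max cl sx xc.
have d2 := pair_swap_center rep_star rep_max cl sx xl.
have bl := penalty_bounds l; have bc := penalty_bounds c.
have Elx : E l x = false.
  by move: d2; rewrite px lc1 /mult; move: Exl => /= ->; case: (E l x) => //; lia.
have pl : penalty l = 5%N by lia.
have Nl : (#|[pred y | 0 < mult l y]| <= 2)%N.
  by move: pl; rewrite /penalty; case: (#|_| <= 2)%N.
have xc' : x != c by apply: contraTneq xc => ->; rewrite multvv.
have sub : [set x; c] \subset [pred y | 0 < mult l y]%N.
  by apply/fintype.subsetP => y; rewrite !inE => /orP[] /eqP ->; rewrite ?lc1 // multC.
have eqN : [set x; c] =i [pred y | 0 < mult l y]%N.
  by apply/subset_cardP => //; apply/eqP; rewrite eqn_leq subset_leq_card //= cards2 xc'.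
(* The arc between [x] and [l] is single and points to [l], so only [c] can be an out-neighbour of
   [l]. *)
have : (o l <= 1)%N.
  rewrite -(card1 c); apply: subset_leq_card; apply/fintype.subsetP => y; rewrite !inE => ly.
  have := eqN y; rewrite !inE /mult ly /= => /orP[/eqP yx|//].
  by rewrite yx Elx in ly.
by rewrite ol.
Qed.

(** A need of at most 1 is paid by one adjacent star. A need of 2 is paid by two of them or, when
    all neighbours lie in one pair, by [triangle_surplus]. *)
Let satellite_surplus x : single rep x -> 0 < need x ->
  need x <= \sum_(c | satellite x c) surplus c.
Proof.
move=> sx nx.
have ge1 c : satellite x c -> 1 <= surplus c.
  by case/and3P => /eqP rc sc _; apply: surplus_center.
have rest (P : pred T) : 0 <= \sum_(c | satellite x c && P c) surplus c.
  by apply: sumr_ge0 => c /andP[/ge1 h _]; apply: le_trans h.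
have adj y : (0 < mult x y)%N -> exists l,
    [/\ pair_block rep (rep y) l, (0 < mult x l)%N & satellite x (rep y)].
  move=> xy; have [l [yl xc xl]] := single_adj_pair rep_star rep_max sx xy.
  by exists l; split=> //; apply: pair_satellite yl xc.
have ox : (0 < o x)%N by case: (needP x) => [|[_]|[_ _ ->]] //; lra.
have [y xy] : exists y, (0 < mult x y)%N.
  by move/card_gt0P: ox => [y]; rewrite inE => xy; exists y; rewrite /mult xy.
have [l [yl xl sy]] := adj y xy.
rewrite (bigD1 (rep y)) //=.
case: (needP x) => [|[nx1 _]|[D2 nx2 ox2]]; first by lra.
  by have := ge1 _ sy; have := rest (fun c => c != rep y); lra.
have [/existsP[c /andP[cy sc]]|/existsPn noc] :=
    boolP [exists c, (c != rep y) && satellite x c].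
  rewrite (bigD1 c) /=; last by rewrite sc.
  have := ge1 _ sy; have := ge1 _ sc.
  have := rest (fun c' => (c' != rep y) && (c' != c)).
  by rewrite /=; under eq_bigl do rewrite andbA; lra.
have : 2 <= surplus (rep y).
  apply: (triangle_surplus sx yl) => //; first by case/and3P: sy.
  move=> z /adj[l' [_ _ sz]]; have := noc (rep z); rewrite sz andbT negbK => rz.
  by case: yl => _ blk; move: rz; rewrite blk => /orP[] /eqP; [left|right].
by have := rest (fun c => c != rep y); lra.
Qed.

(** No surplus is spent twice: both vertices would be adjacent to both ends of one pair, against
    [pair_private]. *)
Let satellite_inj x x' c : single rep x -> single rep x' ->
  satellite x c -> satellite x' c -> x = x'.
Proof.
move=> sx sx' /and3P[/eqP rc _ xc] /and3P[_ _ xc'].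
have [l [cl _ _]] := single_adj_pair rep_star rep_max sx xc.
have [l' [cl' _ xl']] := single_adj_pair rep_star rep_max sx' xc'.
rewrite rc in cl cl'.
have ll : l' = l.
  case: cl cl' => lc blk [lc' blk'].
  by have := blk l; rewrite blk' (negbTE lc) eqxx => /eqP.
by apply: (pair_private rep_star rep_max cl) => //; rewrite -ll.
Qed.

(** Grouped by stars, the difference of the two sides is the sum of the surpluses. Only lone
    vertices of positive need contribute negatively, and their satellites compensate them. *)
Lemma optimal_packing :
  \sum_v need v <= (2 * D + 1)%:R * \sum_v (mult v (rep v))%:R.
Proof.
rewrite -subr_ge0 mulr_sumr -sumrB (partition_big rep predT) //=.
pose bad x := single rep x && (0 < need x).
have nbad c : ~~ bad c -> 0 <= surplus c.
  rewrite /bad; have [rc|rc] := eqVneq (rep c) c; last by rewrite surplus_noncenter.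
  case: (boolP (single rep c)) => [sc|sc _].
    by rewrite /= -leNgt surplus_single // oppr_ge0.
  exact: le_trans (surplus_center rc sc).
rewrite -/(\sum_c surplus c) (bigID bad) /=.
have h1 : \sum_(x | bad x) (- need x) = \sum_(x | bad x) surplus x.
  by apply: eq_bigr => x /andP[sx _]; rewrite surplus_single.
have h2 : \sum_(x | bad x) \sum_(c | satellite x c) surplus c
    <= \sum_(c | ~~ bad c) surplus c.
  rewrite (exchange_big_dep (fun c => ~~ bad c)) /=; last first.
    by move=> x c _ /and3P[_ sc _]; rewrite /bad (negbTE sc).
  apply: ler_sum => c nc.
  have [/existsP[x /andP[bx xc]]|/existsPn nox] :=
      boolP [exists x, bad x && satellite x c]; last first.
    by rewrite big1 ?nbad // => x /andP[bx xc]; have := nox x; rewrite bx xc.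
  rewrite (bigD1 x) /=; last by rewrite bx xc.
  rewrite big1 ?addr0 // => x' /andP[/andP[/andP[sx' _] xc'] xx'].
  case/andP: bx => sx _.
  by rewrite (satellite_inj sx' sx xc' xc) eqxx in xx'.
have h3 : \sum_(x | bad x) need x
    <= \sum_(x | bad x) \sum_(c | satellite x c) surplus c.
  by apply: ler_sum => x /andP[sx nx]; apply: satellite_surplus.
by rewrite -h1 sumrN; lra.
Qed.
End Charging.

Lemma star_packing (R : realFieldType) (D : nat) (need : T -> R) :
  (0 < D <= 2)%N ->
  (forall w, [\/ need w <= 0, need w <= 1 /\ (0 < #|[pred u | E w u]|)%N
    | [/\ D = 2%N, need w <= 2 & #|[pred u | E w u]| = 2%N]]) ->
  exists2 rep : T -> T, star_rep rep &
    \sum_v need v <= (2 * D + 1)%:R * \sum_v (mult v (rep v))%:R.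
Proof.
move=> D12 needP.
pose P (r : {ffun T -> T}) := `[< star_rep r >].
pose id0 : {ffun T -> T} := [ffun v => v].
have Pid : P id0.
  by apply/asboolP; split=> [v|v|u v]; rewrite !ffunE // eqxx.
case: (@Order.TotalTheory.arg_maxP _ _ _ id0 P (fun r => score r) Pid) => rep /asboolP rs rmax.
exists rep => //; apply: (optimal_packing rs) needP => // r hr.
by apply: rmax; apply/asboolP.
Qed.

End Stars.

(** * Heavy vertices *)

(** Take signs minimising the absolute value of the sum. Flipping a set of positive total t turns
    [theta] into [theta] - 2t, so t is at least [theta]. If all contributions exceed [- theta] and
    two are positive, one positive term plus all nonpositive ones is at least [theta], and the other
    positive term makes the whole sum too large. *)
Lemma min_signed_sum (R : realFieldType) (T : finType) (A : {set T}) (s : T -> R) :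
  exists eps : T -> R, let theta := \sum_(v in A) eps v * s v in
  [/\ forall v, eps v = 1 \/ eps v = -1, 0 <= theta &
   [\/ theta = 0, exists2 w, w \in A & eps w * s w <= - theta
     | exists2 v, v \in A & forall u, u \in A -> u != v -> eps u * s u <= 0]].
Proof.
pose sg (X : {set T}) v : R := if v \in X then 1 else -1.
pose th X := \sum_(v in A) sg X v * s v.
have thC X : th (~: X) = - th X.
  rewrite -sumrN; apply: eq_bigr => v _; rewrite /sg inE.
  by case: (v \in X) => /=; ring.
have [X th0 thmin] : exists2 X, 0 <= th X & forall Y, th X <= `|th Y|.
  case: (@Order.TotalTheory.arg_minP _ _ _ finset.set0 xpredT (fun X => `|th X|) isT) => X _ Xmin.
  have [h|h] := leP 0 (th X).
    by exists X => // Y; rewrite -[leLHS]ger0_norm //; exact: Xmin.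
  exists (~: X); first by rewrite thC oppr_ge0 ltW.
  by move=> Y; rewrite thC -ltr0_norm //; exact: Xmin.
exists (sg X); rewrite /= -/(th X); set theta := th X in th0 thmin *.
have sg1 v : sg X v = 1 \/ sg X v = -1 by rewrite /sg; case: (v \in X); [left|right].
split=> //.
have [->|thN0] := eqVneq theta 0; first by constructor 1.
have {th0 thN0} th0 : 0 < theta by rewrite lt_neqAle eq_sym thN0.
pose c v := sg X v * s v.
have flip (S : {set T}) : S \subset A -> 0 < \sum_(v in S) c v -> theta <= \sum_(v in S) c v.
  move=> SA S0; have := thmin [set v | (v \in X) (+) (v \in S)].
  have -> : th [set v | (v \in X) (+) (v \in S)] = theta - 2 * \sum_(v in S) c v.
    rewrite mulr_sumr /theta /th (big_setID S) [in RHS](big_setID S) /=.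
    rewrite (finset.setIidPr SA) addrAC -sumrB; congr (_ + _); apply: eq_bigr => v.
      by rewrite /c /sg inE => ->; case: (v \in X) => /=; ring.
    by rewrite /c /sg !inE => /andP[/negbTE-> _]; rewrite addbF.
  by set t := \sum_(v in S) _ in S0 *; rewrite ler_normr => /orP[]; lra.
have [/existsP[w /andP[wA cw]]|/existsPn noc] :=
    boolP [exists w, (w \in A) && (c w <= - theta)].
  by constructor 2; exists w.
have [/existsP[v /andP[vA cv]]|/existsPn nov] :=
    boolP [exists v, (v \in A) && (0 < c v)]; last first.
  have : theta <= 0.
    by apply: sumr_le0 => v vA; have := nov v; rewrite vA /= -leNgt.
  by lra.
constructor 3; exists v => // u uA uv; rewrite leNgt; apply/negP; rewrite -/(c u) => cu.
(* Adding the nonpositive terms to [c v] one at a time, the partial sums never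
   enter ]0, theta[ by minimality, and each step is shorter than theta. *)
have stay n (S : {set T}) : #|S| = n -> S \subset A -> (forall w, w \in S -> c w <= 0) ->
    theta <= c v + \sum_(w in S) c w.
  elim: n S => [|n IHn] S Sn SA Sneg.
    move/eqP: Sn; rewrite cards_eq0 => /eqP ->; rewrite big_set0 addr0.
    have := flip [set v]; rewrite big_set1; apply=> //.
    by rewrite finset.sub1set.
  have [w wS] : exists w, w \in S by apply/card_gt0P; rewrite Sn.
  have vS : v \notin S by apply/negP => /Sneg; rewrite leNgt cv.
  have := flip (v |: S); rewrite big_setU1 //=; apply.
    by rewrite finset.subUset finset.sub1set vA.
  rewrite (big_setD1 w) //=.
  have : theta <= c v + \sum_(z in S :\ w) c z.
    apply: IHn.
    - by move: Sn; rewrite (cardsD1 w) wS => -[].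
    - exact: fintype.subset_trans (finset.subD1set _ _) SA.
    - by move=> z /finset.setD1P[_ /Sneg].
  have := noc w; rewrite (fintype.subsetP SA) //= -ltNge.
  by lra.
pose S := [set w in A | c w <= 0].
have SA : S \subset A by apply/fintype.subsetP => w; rewrite inE => /andP[].
have Sneg w : w \in S -> c w <= 0 by rewrite inE => /andP[].
have := stay _ S erefl SA Sneg.
have : theta = \sum_(w in S) c w + \sum_(w in A | 0 < c w) c w.
  rewrite /theta /th (bigID (fun w => c w <= 0)) /=; congr (_ + _).
    by apply: eq_bigl => w; rewrite !inE.
  by apply: eq_bigl => w; rewrite -ltNge.
have -> : \sum_(w in A | 0 < c w) c w =
    c v + (c u + \sum_(w in A | [&& 0 < c w, w != v & w != u]) c w).
  rewrite (bigD1 v) ?vA //= (bigD1 u) ?uA ?cu //=.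
  by do 2!congr (_ + _); apply: eq_bigl => w; rewrite !andbA.
have : 0 <= \sum_(w in A | [&& 0 < c w, w != v & w != u]) c w.
  by apply: sumr_ge0 => w /and3P[_ /ltW].
by lra.
Qed.

(** * A biased colouring of the light vertices *)

(** The right-hand side is the probability of crossing forward when light vertices have mean
    [b / 5]. It is 6/25 between light vertices and at least 2/5 when the only heavy end has the
    favourable colour; arcs between heavy vertices are written off by the last term on the left. *)
Lemma biased_arc_forward (R : realFieldType) (E a1 a2 : bool) (x y b : R) :
  x = 1 \/ x = -1 -> y = 1 \/ y = -1 -> b = 1 \/ b = -1 ->
  E%:R / 5 + E%:R * (a1%:R * x - a2%:R * y) / 5 - 3 / 5 * (a1%:R * a2%:R) <=
  E%:R * (1 + if a1 then x else b / 5) * (1 - if a2 then y else b / 5) / 4.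
Proof.
by case: E; case: a1; case: a2 => -[] ? [] ? [] ?; subst => /=; lra.
Qed.

(** On the arcs marked by [H], the light end leans away from the heavy one, which raises the
    probability from 2/5 to 3/5. *)
Lemma biased_arc_backward (R : realFieldType) (E a1 a2 H : bool) (x y b : R) :
  x = 1 \/ x = -1 -> y = 1 \/ y = -1 -> b = 1 \/ b = -1 ->
  (H -> [/\ ~~ a1, a2, y = 1 & b = -1] \/ [/\ a1, ~~ a2, x = -1 & b = 1]) ->
  E%:R / 5 - E%:R * (a1%:R * x - a2%:R * y) / 5 + E%:R * H%:R / 5
    - 3 / 5 * (a1%:R * a2%:R) <=
  E%:R * (1 - if a1 then x else b / 5) * (1 + if a2 then y else b / 5) / 4.
Proof.
case: H => [hx hy hb /(_ isT)[[/negbTE -> -> -> ->]|[-> /negbTE -> -> ->]]|].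
- by case: E => /=; lra.
- by case: E => /=; lra.
by case: E; case: a1; case: a2 => -[] ? [] ? [] ? _; subst => /=; lra.
Qed.

(** [p] is the arc to the dominant vertex; [x] and [y] count the other heavy and the light
    out-neighbours. If [p] holds, at least D of these remain, so 2D - y - 2x is at most D - x. *)
Lemma need_in (D x y : nat) (p : bool) : (0 < D <= 2)%N -> (D + 1 <= p + x + y)%N ->
  (2 * D * p <= y + 2 * x)%N \/ (2 * D * p <= y + 2 * x + 1 /\ 0 < y)%N \/
  (D = 2 /\ 2 * D * p <= y + 2 * x + 2 /\ y = 2)%N.
Proof. by case: D => [|[|[|//]]] // _; case: p => /=; lia. Qed.

(** Here [p] is the arc from the dominant vertex and [q] the arc back. The latter alone outweighs
    2D; without it, D + 1 other out-neighbours leave a need of at most D - 1. *)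
Lemma need_out (D x y : nat) (p q : bool) : (0 < D <= 2)%N -> (D + 1 <= q + x + y)%N ->
  (2 * D * p <= y + 2 * x + (2 * D + 2) * q)%N \/
  (2 * D * p <= y + 2 * x + (2 * D + 2) * q + 1 /\ 0 < y)%N \/
  (D = 2 /\ 2 * D * p <= y + 2 * x + (2 * D + 2) * q + 2 /\ y = 2)%N.
Proof. by case: D => [|[|[|//]]] // _; case: p; case: q => /=; lia. Qed.

Section Partition.
Variables (R : realFieldType) (T : finType) (E : rel T).
Hypothesis E_irr : irreflexive E.

Let e (u w : T) : R := (E u w)%:R.
Let m : R := wsize e.
Hypothesis m_gt0 : 0 < m.

Definition degree (v : T) : R := \sum_w (e v w + e w v).

Variable delta : R.
Hypothesis delta_gt0 : 0 < delta.
Definition heavy : {set T} := [set v | delta * m < degree v].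

Let e_ge0 u w : 0 <= e u w. Proof. by rewrite /e. Qed.
Let e_le1 u w : e u w <= 1. Proof. by rewrite /e; case: (E u w). Qed.

Lemma sum_degree : \sum_v degree v = 2 * m.
Proof.
rewrite /degree; under eq_bigr do rewrite big_split /=.
by rewrite big_split /= [X in _ + X]exchange_big /= /m /wsize; ring.
Qed.

Lemma degree_ge0 v : 0 <= degree v.
Proof. by apply: sumr_ge0 => w _; rewrite addr_ge0. Qed.

Lemma excess_le_degree v : `|excess e v| <= degree v.
Proof.
have h1 : 0 <= \sum_w e v w by apply: sumr_ge0.
have h2 : 0 <= \sum_w e w v by apply: sumr_ge0.
by rewrite /excess /degree big_split /= ler_norml; apply/andP; split; lra.
Qed.

Lemma card_degree_gt (c : R) : 0 <= c ->
  \sum_(v | c < degree v) c <= 2 * m.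
Proof.
move=> c0; rewrite -sum_degree big_mkcond /=; apply: ler_sum => v _.
by case: ltP => [/ltW|_] //; apply: degree_ge0.
Qed.

(** Degrees sum to [2 * m]. The bound does not depend on [m], which makes the arcs inside [heavy]
    negligible. *)
Lemma card_heavy : #|heavy|%:R * delta <= 2.
Proof.
have := @card_degree_gt (delta * m) (mulr_ge0 (ltW delta_gt0) (ltW m_gt0)).
rewrite (eq_bigl (mem heavy)) => [|v]; last by rewrite !inE.
by rewrite sumr_const -[_ *+ _]mulr_natl mulrA ler_pM2r.
Qed.

Definition Elight u w := [&& E u w, u \notin heavy & w \notin heavy].

Let a v : R := (v \in heavy)%:R.

Lemma sum_heavy_pairs : \sum_u \sum_w a u * a w = #|heavy|%:R ^+ 2.
Proof.
have aE : \sum_u a u = #|heavy|%:R.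
  rewrite -sum1_card natr_sum [RHS]big_mkcond /=; apply: eq_bigr => v _.
  by rewrite /a; case: (v \in heavy).
by rewrite expr2 -{1}aE mulr_suml; apply: eq_bigr => u _; rewrite -mulr_sumr aE.
Qed.

Variable eps : T -> R.
Hypothesis eps1 : forall v, eps v = 1 \/ eps v = -1.
Let theta := \sum_(v in heavy) eps v * excess e v.

Let a01 v : a v = 0 \/ a v = 1.
Proof. by rewrite /a; case: (v \in heavy); [right|left]. Qed.

Lemma theta_arcs : theta = \sum_u \sum_w e u w * (a u * eps u - a w * eps w).
Proof.
rewrite -(sum_excess e (fun v => a v * eps v)) /theta [LHS]big_mkcond /=. apply: eq_bigr => v _.
by rewrite /a; case: (v \in heavy) => /=; ring.
Qed.

(** Light vertices lean away from [w0]. The forward bound gains [theta / 5]. The backward one loses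
    as much, but at least [theta] arcs at [w0] run backward, and all but [#|heavy|] of them have a
    light end and gain 1/5 each. *)
Lemma biased_partition (eta : R) w0 : 0 < eta <= 1 -> 2 * delta <= eta ^+ 3 / 2 ->
  0 <= theta -> w0 \in heavy -> eps w0 * excess e w0 <= - theta ->
  exists V : pred T,
    m / 5 - #|heavy|%:R ^+ 2 - eta * m <= wcross e V /\
    m / 5 - #|heavy|%:R ^+ 2 - eta * m <= wcross e (predC V).
Proof.
move=> eta01 hdelta th0 w0A hw0.
pose beta : R := - eps w0.
pose mu v := if v \in heavy then eps v else beta / 5.
have beta1 : beta = 1 \/ beta = -1.
  by rewrite /beta; case: (eps1 w0) => ->; [right|left; rewrite opprK].
have mu1 v : `|mu v| <= 1.
  rewrite /mu; case: (v \in heavy).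
    by case: (eps1 v) => ->; rewrite ?normrN normr1.
  by rewrite ler_norml; case: beta1 => ->; apply/andP; split; lra.
pose rep (v : T) := v; pose k (v : T) : R := 1.
have k1 v : k v = 1 \/ k v = -1 by left.
have beE r : bexcess e rep k r = excess e r.
  by rewrite /bexcess /rep big_pred1_eq /k mulr1.
(* Heavy vertices are deterministic, and a light one has excess at most [delta * m]. *)
have hvar : \sum_r bexcess e rep k r ^+ 2 * (1 - mu r ^+ 2) <= eta ^+ 3 / 2 * m ^+ 2.
  apply: (@le_trans _ _ (\sum_r delta * m * degree r)); last first.
    rewrite -mulr_sumr sum_degree; have := ler_wpM2r (sqr_ge0 m) hdelta; lra.
  apply: ler_sum => r _; rewrite beE /mu; case: (boolP (r \in heavy)) => [rA|].
    have -> : eps r ^+ 2 = 1 by case: (eps1 r) => ->; ring.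
    by rewrite subrr mulr0 !mulr_ge0 ?degree_ge0 // ltW.
  rewrite inE -leNgt => hr.
  have : excess e r ^+ 2 <= degree r ^+ 2.
    by rewrite -real_normK ?num_real // ler_pXn2r ?nnegrE ?degree_ge0 ?excess_le_degree.
  have := ler_wpM2r (degree_ge0 r) hr; rewrite -expr2.
  have : 0 <= excess e r ^+ 2 * (beta / 5) ^+ 2 by rewrite mulr_ge0 ?sqr_ge0.
  by lra.
have [V [hV1 hV2]] := judicious_round e_ge0 k1 mu1 eta01 m_gt0 hvar.
have discE : edisc e rep k mu = \sum_u \sum_w e u w * (mu u - mu w).
  by rewrite /edisc sum_excess; apply: eq_bigr => u _; apply: eq_bigr => w _; rewrite /k !mul1r.
have cutE : ecut e rep k mu = \sum_u \sum_w e u w * (1 - mu u * mu w) / 2.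
  apply: eq_bigr => u _; apply: eq_bigr => w _; rewrite /corr /k /rep.
  case: eqP => [->|_]; last by rewrite !mul1r.
  by rewrite /e E_irr !mul0r.
have low1 : m / 5 + theta / 5 - 3 / 5 * #|heavy|%:R ^+ 2 <=
    (ecut e rep k mu + edisc e rep k mu / 2) / 2.
  rewrite theta_arcs -sum_heavy_pairs discE cutE /m /wsize !mulr_suml mulr_sumr.
  rewrite -!big_split -sumrB /= mulr_suml; apply: ler_sum => u _.
  rewrite !mulr_suml mulr_sumr -!big_split -sumrB /= mulr_suml; apply: ler_sum => w _.
  have := biased_arc_forward (E u w) (u \in heavy) (w \in heavy) (eps1 u) (eps1 w) beta1.
  by rewrite -/(e u w) -/(a u) -/(a w) -/(mu u) -/(mu w); lra.
(* Arcs between [w0] and light vertices that cross backward if at all: into [w0] when its colour is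
   1, out of it otherwise. *)
pose H u w := if eps w0 == 1 then (w == w0) && (u \notin heavy)
  else (u == w0) && (w \notin heavy).
pose h u w : R := (H u w)%:R.
have n1 : (-1 == 1 :> R) = false by apply/negbTE/eqP; lra.
have hE u w : h u w =
    if eps w0 == 1 then (w == w0)%:R * (1 - a u) else (u == w0)%:R * (1 - a w).
  rewrite /h /H /a; case: (eps w0 == 1); [case: (u \in heavy)|case: (w \in heavy)] => /=;
    by case: (_ == w0); rewrite /= ?mul1r ?mul0r ?subr0 ?subrr.
have hsum : theta - #|heavy|%:R <= \sum_u \sum_w e u w * h u w.
  have sA : \sum_u a u = #|heavy|%:R.
    rewrite -sum1_card natr_sum [RHS]big_mkcond /=; apply: eq_bigr => v _.
    by rewrite /a; case: (v \in heavy).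
  have out0 : 0 <= \sum_w e w0 w by apply: sumr_ge0.
  have in0 : 0 <= \sum_w e w w0 by apply: sumr_ge0.
  have keep (f : T -> R) : (forall u, 0 <= f u <= 1) ->
      \sum_u f u - #|heavy|%:R <= \sum_u f u * (1 - a u).
    move=> f01; rewrite -sA -sumrB; apply: ler_sum => u _.
    by have /andP[] := f01 u; case: (a01 u) => ->; lra.
  have e01 u w : 0 <= e u w <= 1 by rewrite e_ge0 e_le1.
  under eq_bigr do under eq_bigr do rewrite hE.
  case: (eps1 w0) hw0 => -> hw0; rewrite ?n1 ?eqxx.
    have -> : \sum_u \sum_w e u w * ((w == w0)%:R * (1 - a u)) =
        \sum_u e u w0 * (1 - a u).
      apply: eq_bigr => u _; rewrite (bigD1 w0) //= eqxx mul1r big1 ?addr0 // => w.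
      by move=> /negbTE ->; rewrite mul0r mulr0.
    have := keep (fun u => e u w0) (fun u => e01 _ _).
    by rewrite /excess in hw0; lra.
  have -> : \sum_u \sum_w e u w * ((u == w0)%:R * (1 - a w)) =
      \sum_w e w0 w * (1 - a w).
    rewrite (bigD1 w0) //= eqxx [X in _ + X]big1 ?addr0 => [|u].
      by apply: eq_bigr => w _; rewrite mul1r.
    by move=> /negbTE ->; apply: big1 => w _; rewrite mul0r mulr0.
  have := keep (fun w => e w0 w) (fun w => e01 _ _).
  by rewrite /excess in hw0; lra.
have low2 : m / 5 - theta / 5 + 1 / 5 * (\sum_u \sum_w e u w * h u w)
     - 3 / 5 * #|heavy|%:R ^+ 2 <=
    (ecut e rep k mu - edisc e rep k mu / 2) / 2.
  rewrite theta_arcs -sum_heavy_pairs discE cutE /m /wsize !mulr_suml !mulr_sumr.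
  rewrite -!sumrB -big_split -sumrB /= mulr_suml; apply: ler_sum => u _.
  rewrite !mulr_suml !mulr_sumr -!sumrB -big_split -sumrB /= mulr_suml; apply: ler_sum => w _.
  have Hcase : H u w -> [/\ u \notin heavy, w \in heavy, eps w = 1 & beta = -1] \/
      [/\ u \in heavy, w \notin heavy, eps u = -1 & beta = 1].
    rewrite /H /beta; case: (eps1 w0) => h0; rewrite h0 ?n1 ?eqxx => /andP[/eqP -> h1].
      by left.
    by right; rewrite opprK.
  have := biased_arc_backward (E u w) (eps1 u) (eps1 w) beta1 Hcase.
  by rewrite -/(e u w) -/(a u) -/(a w) -/(mu u) -/(mu w) -/(h u w); lra.
have A1 : #|heavy|%:R <= #|heavy|%:R ^+ 2 :> R.
  rewrite -natrX ler_nat; case: (#|heavy|) => // n; exact: leq_pmulr.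
have A0 : 0 <= #|heavy|%:R :> R by [].
by exists V; split; [move: hV1 low1 | move: hV2 low2 hsum]; rewrite -/m; lra.
Qed.

(** * Colouring light stars independently *)

Section Blocks.
Variables (rep : T -> T) (eta L : R).
Hypothesis rep_star : star_rep Elight rep.
Hypotheses (eta01 : 0 < eta <= 1) (L_gt0 : 0 < L).
Hypothesis delta_small : 2 * (1 + L) * delta <= eta ^+ 3 / 2.

Let mu v := if v \in heavy then eps v else 0.
(* Leaves of large degree are dropped to keep the weight of each star small. *)
Let rep' v := if L < degree v then v else rep v.
Let k v : R := if rep' v == v then 1 else -1.

Let rep_light v : rep v != v -> (v \notin heavy) && (rep v \notin heavy).
Proof.
case: rep_star => _ radj _ /radj; rewrite /mult /Elight.
by case: (v \notin heavy); case: (rep v \notin heavy); rewrite ?andbF.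
Qed.

Let rep'P v : rep' v = v \/ [/\ rep' v = rep v, rep v != v & degree v <= L].
Proof.
rewrite /rep'; case: ltP => h; first by left.
by have [->|rv] := eqVneq (rep v) v; [left|right].
Qed.

Let rep'K v : rep' (rep' v) = rep' v.
Proof.
have [rr _ _] := rep_star.
case: (rep'P v) => [h|[h _ _]]; rewrite !h //.
by rewrite /rep'; case: ifP => // _; apply: rr.
Qed.

Let rep'_heavy v : v \in heavy -> rep' v = v.
Proof. by move=> vA; case: (rep'P v) => // -[_ /rep_light]; rewrite vA. Qed.

Let rep'_light v : v \notin heavy -> rep' v \notin heavy.
Proof. by move=> vA; case: (rep'P v) => [->|[-> /rep_light/andP[]]]. Qed.

Let mu_light v : v \notin heavy -> mu (rep' v) = 0.
Proof. by move=> vA; rewrite /mu (negbTE (rep'_light vA)). Qed.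

Let k1 v : k v = 1 \/ k v = -1.
Proof. by rewrite /k; case: (_ == _); [left|right]. Qed.

Let mu1 v : `|mu v| <= 1.
Proof.
rewrite /mu; case: (v \in heavy); last by rewrite normr0.
by case: (eps1 v) => ->; rewrite ?normrN normr1.
Qed.

Let mult_le u w : (mult Elight u w)%:R <= e u w + e w u.
Proof.
rewrite /mult natrD; apply: lerD; rewrite ler_nat /Elight;
by case: (E _ _) => //=; case: (_ && _).
Qed.

Let weight r := \sum_(v | rep' v == r) degree v.

(** Each leaf kept has degree at most [L] and uses up an arc at the centre, so the block weighs at
    most [1 + L] times the degree of its centre. *)
Let weight_light r : r \notin heavy -> weight r <= (1 + L) * (delta * m).
Proof.
move=> rA; have dr : degree r <= delta * m by move: rA; rewrite inE -leNgt.
apply: (@le_trans _ _ ((1 + L) * degree r)); last first.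
  by rewrite ler_wpM2l // ltW // addr_gt0.
rewrite mulrDl mul1r {2}/degree mulr_sumr.
have -> : degree r = \sum_v (v == r)%:R * degree r.
  rewrite (bigD1 r) //= eqxx mul1r big1 ?addr0 // => v /negbTE ->.
  by rewrite mul0r.
rewrite -big_split /weight big_mkcond; apply: ler_sum => v _ /=.
have d0 := degree_ge0 r; have e2 : 0 <= e r v + e v r by rewrite addr_ge0.
case: eqP => [rv|_]; last by rewrite addr_ge0 // mulr_ge0 // ltW.
have [->|vr] := eqVneq v r.
  by rewrite mul1r lerDl mulr_ge0 ?(ltW L_gt0) // addr_ge0.
rewrite mul0r add0r; case: (rep'P v) => [h|[h rvv dv]].
  by rewrite -rv h eqxx in vr.
apply: (le_trans dv); rewrite ler_peMr ?(ltW L_gt0) //.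
rewrite addrC; apply: le_trans (mult_le v r).
rewrite (ler_nat _ 1) -rv h; have [_ radj _] := rep_star; exact: radj.
Qed.

Let block_variance : \sum_r bexcess e rep' k r ^+ 2 * (1 - mu r ^+ 2)
  <= eta ^+ 3 / 2 * m ^+ 2.
Proof.
apply: (@le_trans _ _ (\sum_r (1 + L) * (delta * m) * weight r)); last first.
  rewrite -mulr_sumr.
  have -> : \sum_r weight r = 2 * m.
    by rewrite -sum_degree [RHS](partition_big rep' predT).
  have := ler_wpM2r (sqr_ge0 m) delta_small; lra.
apply: ler_sum => r _; have W0 : 0 <= weight r.
  by apply: sumr_ge0 => v _; apply: degree_ge0.
have c0 : 0 <= (1 + L) * (delta * m) by rewrite !mulr_ge0 // ?addr_ge0 // ltW.
case: (boolP (r \in heavy)) => rA; rewrite /mu.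
  rewrite rA; have -> : eps r ^+ 2 = 1 by case: (eps1 r) => ->; ring.
  by rewrite subrr mulr0 mulr_ge0.
rewrite (negbTE rA) expr0n subr0 mulr1.
have bW : `|bexcess e rep' k r| <= weight r.
  apply: (le_trans (ler_norm_sum _ _ _)); apply: ler_sum => v _.
  rewrite normrM; case: (k1 v) => ->; rewrite ?normrN normr1 mulr1;
  exact: excess_le_degree.
have := ler_wpM2r W0 (weight_light rA).
apply: le_trans; rewrite -expr2 -[leLHS]real_normK ?num_real //.
by rewrite ler_pXn2r ?nnegrE ?normr_ge0.
Qed.

(** At most [2 * m / L] vertices have degree above [L], and dropping one gives up at most two
    arcs. *)
Let kept : \sum_v (mult Elight v (rep v))%:R - 4 * m / L <=
  \sum_v (mult Elight v (rep' v))%:R :> R.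
Proof.
have h : \sum_(v | L < degree v) 1 <= 2 * m / L.
  rewrite ler_pdivlMr // mulr_suml.
  by under eq_bigr do rewrite mul1r; apply: card_degree_gt (ltW L_gt0).
have : \sum_v (mult Elight v (rep v))%:R <=
    \sum_v ((mult Elight v (rep' v))%:R + (if L < degree v then 2 else 0)) :> R.
  apply: ler_sum => v _; rewrite /rep'; case: ifP => _; last by rewrite addr0.
  by rewrite -[leLHS]add0r lerD // (ler_nat _ _ 2) mult_le2.
rewrite big_split /= -[X in _ + X]big_mkcond /=.
have -> : \sum_(v | L < degree v) 2 = 2 * \sum_(v | L < degree v) 1 :> R.
  by rewrite mulr_sumr mulr1.
by lra.
Qed.

(** An arc between different blocks is cut with probability 1/2 unless both ends are heavy, the case
    written off by the square. An arc from centre to leaf or back is always cut, and stars being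
    induced, no arc joins two leaves of a block. *)
Let cut_lower : m / 2 - #|heavy|%:R ^+ 2 / 2
    + (\sum_v (mult Elight v (rep' v))%:R) / 2 <= ecut e rep' k mu.
Proof.
pose b u w : R := (Elight u w)%:R.
have -> : \sum_v (mult Elight v (rep' v))%:R =
    \sum_u \sum_w b u w * ((rep' u == w)%:R + (rep' w == u)%:R).
  transitivity (\sum_u \sum_w b u w * (rep' u == w)%:R +
      \sum_u \sum_w b u w * (rep' w == u)%:R).
    rewrite [X in _ + X]exchange_big -big_split; apply: eq_bigr => v _ /=.
    rewrite /mult natrD; congr (_ + _).
      rewrite (bigD1 (rep' v)) //= eqxx mulr1 big1 ?addr0 // => w.
      by rewrite eq_sym => /negbTE ->; rewrite mulr0.
    rewrite (bigD1 (rep' v)) //= eqxx mulr1 big1 ?addr0 // => w.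
    by rewrite eq_sym => /negbTE ->; rewrite mulr0.
  rewrite -big_split; apply: eq_bigr => u _ /=; rewrite -big_split.
  by apply: eq_bigr => w _ /=; rewrite mulrDr.
rewrite -sum_heavy_pairs /m /wsize /ecut !mulr_suml -sumrB -big_split.
apply: ler_sum => u _ /=; rewrite !mulr_suml -sumrB -big_split.
apply: ler_sum => w _ /=.
rewrite /b /e /Elight; case Euw: (E u w) => /=; last first.
  by case: (a01 u) => ->; case: (a01 w) => ->; lra.
have uw : u != w by apply: contraTneq Euw => ->; rewrite E_irr.
have [rr _ rind] := rep_star.
rewrite /corr /a; have [ru|ru] := eqVneq (rep' u) (rep' w).
  case: (boolP (u \in heavy)) => uA; case: (boolP (w \in heavy)) => wA /=.
  - by move: uw; rewrite -(rep'_heavy uA) ru rep'_heavy // eqxx.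
  - by have := rep'_light wA; rewrite -ru rep'_heavy // uA.
  - by have := rep'_light uA; rewrite ru rep'_heavy // wA.
  rewrite /k; have [uc|uc] := eqVneq (rep' u) u; have [wc|wc] := eqVneq (rep' w) w.
  - by move: uw; rewrite -uc ru wc eqxx.
  - by rewrite -ru uc eqxx (negbTE uw) /=; lra.
  - by rewrite ru wc eqxx eq_sym (negbTE uw) /=; lra.
  - case: (rep'P u) => [h|[hu ru1 _]]; first by rewrite h eqxx in uc.
    case: (rep'P w) => [h|[hw rw1 _]]; first by rewrite h eqxx in wc.
    have := rind u w; rewrite -hu -hw => /(_ ru uc wc).
    by rewrite /mult /Elight Euw uA wA.
have nru : (rep' u == w) = false.
  by apply/negbTE; apply: contraNneq ru => uE; rewrite -uE rep'K.
have nrw : (rep' w == u) = false.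
  by apply/negbTE; apply: contraNneq ru => wE; rewrite -wE rep'K.
rewrite nru nrw.
case: (boolP (u \in heavy)) => uA; last first.
  by rewrite (mu_light uA) /=; case: (w \in heavy); lra.
case: (boolP (w \in heavy)) => wA; last first.
  by rewrite (mu_light wA) /=; lra.
rewrite /k !rep'_heavy // !eqxx /mu uA wA /=.
by case: (eps1 u) => ->; case: (eps1 w) => ->; lra.
Qed.

Lemma block_partition : let B : R :=
    (m + \sum_v (mult Elight v (rep v))%:R - `|theta|) / 4
      - #|heavy|%:R ^+ 2 - m / L - eta * m in
  exists V : pred T, B <= wcross e V /\ B <= wcross e (predC V).
Proof.
move=> B; have [V [hV1 hV2]] := judicious_round e_ge0 k1 mu1 eta01 m_gt0 block_variance.
(* Light blocks have mean 0, so the heavy vertices alone make up the expected imbalance. *)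
have discE : edisc e rep' k mu = theta.
  rewrite /edisc /theta [RHS]big_mkcond /=; apply: eq_bigr => v _.
  case: (boolP (v \in heavy)) => vA; last by rewrite mu_light // !mulr0.
  by rewrite /k rep'_heavy // eqxx mul1r /mu vA mulrC.
rewrite discE -/m in hV1 hV2.
have /andP[tN tP] : - `|theta| <= theta <= `|theta| by rewrite -ler_norml.
have A0 : 0 <= #|heavy|%:R ^+ 2 :> R by rewrite exprn_ge0.
have hk := kept; have hc := cut_lower.
by exists V; rewrite /B; split; [move: hV1 | move: hV2]; lra.
Qed.

End Blocks.

(** * A single heavy vertex of positive contribution *)

Section Dominant.
Variables (D : nat) (v0 : T).
Hypothesis D12 : (0 < D <= 2)%N.
Hypothesis outdegE : forall v, (D + 1 <= #|[pred w | E v w]|)%N.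
Hypothesis v0A : v0 \in heavy.
Hypothesis others : forall u, u \in heavy -> u != v0 -> eps u * excess e u <= 0.

Let h v : R := (v \in heavy)%:R * (v != v0)%:R.
Let kk w := #|[pred u | [&& E w u, u \in heavy & u != v0]]|.
Let o w := #|[pred u | Elight w u]|.

Let h01 v : [\/ h v = 0 /\ a v = 0, h v = 1 /\ a v = 1 | [/\ h v = 0, a v = 1 & v = v0]].
Proof.
rewrite /h /a; case: (v \in heavy); last by rewrite mul0r; constructor 1.
by have [->|_] := eqVneq v v0; rewrite ?mulr0 ?mulr1; [constructor 3|constructor 2].
Qed.

Let card_sum_indicator (P : pred T) : #|P| = (\sum_u P u)%N.
Proof. by rewrite -sum1_card big_mkcond; apply: eq_bigr => u _; rewrite unfold_in; case: (P u). Qed.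

Let out_split w : w \notin heavy -> (D + 1 <= E w v0 + kk w + o w)%N.
Proof.
move=> wA; apply: (leq_trans (outdegE w)).
rewrite /kk /o !card_sum_indicator.
have -> : E w v0 = (\sum_u (E w u && (u == v0)))%N :> nat.
  by rewrite (bigD1 v0) //= eqxx andbT big1 ?addn0 // => u /negbTE ->; rewrite andbF.
rewrite -!big_split /=; apply: leq_sum => u _; rewrite /= /Elight wA.
case: (E w u) => //=; have [->|_] := eqVneq u v0; first by rewrite v0A.
by case: (u \in heavy).
Qed.

(** Arcs by class: the letter S is for [v0], K for the other heavy vertices, O for light arcs; a
    prime marks arcs that leave the heavy end. *)
Let S1 := \sum_u (1 - a u) * e u v0.
Let S1' := \sum_w (1 - a w) * e v0 w.
Let K := \sum_u \sum_w (1 - a u) * h w * e u w.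
Let K' := \sum_u \sum_w h u * (1 - a w) * e u w.
Let O := \sum_u \sum_w (1 - a u) * (1 - a w) * e u w.

Let arcs_le : S1 + S1' + K + K' + O <= m.
Proof.
have -> : S1 = \sum_u \sum_w (1 - a u) * (w == v0)%:R * e u w.
  apply: eq_bigr => u _; rewrite (bigD1 v0) //= eqxx mulr1 big1 ?addr0 // => w.
  by move/negbTE ->; rewrite mulr0 mul0r.
have -> : S1' = \sum_u \sum_w (u == v0)%:R * (1 - a w) * e u w.
  rewrite (bigD1 v0) //= [X in _ + X]big1 ?addr0 => [|u /negbTE ->].
    by apply: eq_bigr => w _; rewrite eqxx mul1r.
  by apply: big1 => w _; rewrite !mul0r.
rewrite -!big_split; apply: ler_sum => u _ /=; rewrite -!big_split.
apply: ler_sum => w _ /=; have := e_ge0 u w; rewrite /h /a.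
case: eqP => [->|_]; case: eqP => [->|_]; rewrite ?v0A;
  by case: (u \in heavy); case: (w \in heavy) => /=; lra.
Qed.

Let excess_v0 : `|excess e v0 - (S1' - S1)| <= #|heavy|%:R.
Proof.
have -> : #|heavy|%:R = \sum_u a u.
  rewrite -sum1_card natr_sum [LHS]big_mkcond /=; apply: eq_bigr => v _.
  by rewrite /a; case: (v \in heavy).
rewrite /excess /S1 /S1' -!sumrB; apply: (le_trans (ler_norm_sum _ _ _)).
apply: ler_sum => w _; have := e_ge0 w v0; have := e_le1 w v0.
have := e_ge0 v0 w; have := e_le1 v0 w; rewrite ler_norml.
by case: (a01 w) => -> *; apply/andP; split; lra.
Qed.

Let excess_rest : `|\sum_v excess e v * h v - (K' - K)| <= #|heavy|%:R ^+ 2.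
Proof.
rewrite sum_excess -sum_heavy_pairs /K /K' -!sumrB.
apply: (le_trans (ler_norm_sum _ _ _)); apply: ler_sum => u _.
rewrite -!sumrB; apply: (le_trans (ler_norm_sum _ _ _)); apply: ler_sum => w _.
have := e_ge0 u w; have := e_le1 u w; rewrite ler_norml.
case: (h01 u) => [[-> ->]|[-> ->]|[-> -> _]]; case: (h01 w) => [[-> ->]|[-> ->]|[-> -> _]];
by move=> *; apply/andP; split; lra.
Qed.

(** The contribution of any other heavy vertex is nonpositive, hence minus its absolute excess,
    which is at most the excess taken with either sign. *)
Let theta_le (sg : R) : sg = 1 \/ sg = -1 ->
  theta <= eps v0 * excess e v0 + sg * \sum_v excess e v * h v.
Proof.
move=> sg1; have -> : eps v0 * excess e v0 = \sum_v (v == v0)%:R * (eps v0 * excess e v0).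
  by rewrite (bigD1 v0) //= eqxx mul1r big1 ?addr0 // => v /negbTE ->; rewrite mul0r.
rewrite /theta big_mkcond mulr_sumr -big_split; apply: ler_sum => v _ /=.
rewrite /h; case: (boolP (v \in heavy)) => vA; last first.
  rewrite mul0r !mulr0 addr0; have [vE|_] := eqVneq v v0; last by rewrite mul0r.
  by rewrite vE v0A in vA.
have [->|vN] := eqVneq v v0; first by rewrite /= !mulr0 mul1r addr0.
have := others vA vN; case: (eps1 v) => ->; case: sg1 => -> /=; lra.
Qed.

Let count_kk : \sum_(w | w \notin heavy) (kk w)%:R = K.
Proof.
rewrite /K big_mkcond; apply: eq_bigr => w _; rewrite /a.
case: (w \in heavy) => /=; first by rewrite big1 // => u _; rewrite subrr !mul0r.
rewrite /kk card_sum_indicator natr_sum; apply: eq_bigr => u _; rewrite /= /h /e.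
by case: (E w u); case: (u \in heavy); case: (u != v0) => /=; ring.
Qed.

Let count_o : \sum_(w | w \notin heavy) (o w)%:R = O.
Proof.
rewrite /O big_mkcond; apply: eq_bigr => w _; rewrite /a.
case: (boolP (w \in heavy)) => wA /=; first by rewrite big1 // => u _; rewrite subrr !mul0r.
rewrite /o card_sum_indicator natr_sum; apply: eq_bigr => u _; rewrite /= /Elight /e wA.
by case: (E w u); case: (u \in heavy) => /=; ring.
Qed.

Let count_in : \sum_(w | w \notin heavy) (E w v0)%:R = S1.
Proof.
rewrite /S1 big_mkcond; apply: eq_bigr => w _; rewrite /a /e.
by case: (w \in heavy) => /=; ring.
Qed.

Let count_out : \sum_(w | w \notin heavy) (E v0 w)%:R = S1'.
Proof.
rewrite /S1' big_mkcond; apply: eq_bigr => w _; rewrite /a /e.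
by case: (w \in heavy) => /=; ring.
Qed.

Let need_cast (p n y : nat) :
  (p <= n)%N \/ (p <= n + 1 /\ 0 < y)%N \/ (D = 2 /\ p <= n + 2 /\ y = 2)%N ->
  [\/ p%:R - n%:R <= 0 :> R, p%:R - n%:R <= 1 :> R /\ (0 < y)%N
    | [/\ D = 2%N, p%:R - n%:R <= 2 :> R & y = 2%N]].
Proof.
rewrite -!(ler_nat R) !natrD.
by case=> [pn|[[pn y0]|[D2 [pn y2]]]]; [constructor 1|constructor 2|constructor 3];
  rewrite ?lerBlDl ?addr0 //.
Qed.

Lemma dominant_packing : exists2 rep : T -> T, star_rep Elight rep &
  (2 * D + 1)%:R * theta <= m + (2 * D + 1)%:R * \sum_v (mult Elight v (rep v))%:R
    + 10 * #|heavy|%:R ^+ 2.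
Proof.
have El_irr : irreflexive Elight by move=> v; rewrite /Elight E_irr.
have A1 : #|heavy|%:R <= #|heavy|%:R ^+ 2 :> R.
  rewrite -natrX ler_nat; case: (#|heavy|) => // n; exact: leq_pmulr.
have hm := arcs_le.
have /andP[hv1 hv2] : - #|heavy|%:R <= excess e v0 - (S1' - S1) <= #|heavy|%:R.
  by rewrite -ler_norml excess_v0.
have /andP[hr1 hr2] : - #|heavy|%:R ^+ 2 <= \sum_v excess e v * h v - (K' - K)
    <= #|heavy|%:R ^+ 2 by rewrite -ler_norml excess_rest.
have t1 := theta_le (or_introl erefl); have t2 := theta_le (or_intror erefl).
set X := \sum_v excess e v * h v in hr1 hr2 t1 t2.
have S10 : 0 <= S1 by rewrite -count_in sumr_ge0.
have S10' : 0 <= S1' by rewrite -count_out sumr_ge0.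
have K0 : 0 <= K by rewrite -count_kk sumr_ge0.
have O0 : 0 <= O by rewrite -count_o sumr_ge0.
case: (eps1 v0) => e0; rewrite e0 ?mul1r ?mulN1r in t1 t2.
(* The bounds [t1] and [t2] are averaged with weights differing by 1 / (2D + 1): in [m] minus (2D +
   1) [theta] this cancels [K'], leaves [2 K], and gives [S1'] the coefficient -2D. *)
- pose nd w : R := if w \in heavy then 0 else
    (2 * D)%:R * (E v0 w)%:R - (o w)%:R - 2 * (kk w)%:R - (2 * D + 2)%:R * (E w v0)%:R.
  have sum_nd : \sum_w nd w = (2 * D)%:R * S1' - O - 2 * K - (2 * D + 2)%:R * S1.
    rewrite -count_in -count_out -count_o -count_kk !mulr_sumr -!sumrB [RHS]big_mkcond /=.
    by apply: eq_bigr => w _; rewrite /nd; case: (w \in heavy).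
  have [||rep rs hrep] := @star_packing T Elight El_irr R D nd => //.
    move=> w; rewrite /nd; case: (boolP (w \in heavy)) => wA; first by constructor 1.
    have -> : (2 * D)%:R * (E v0 w)%:R - (o w)%:R - 2 * (kk w)%:R
          - (2 * D + 2)%:R * (E w v0)%:R =
        (2 * D * E v0 w)%:R - (o w + 2 * kk w + (2 * D + 2) * E w v0)%:R :> R.
      by rewrite !natrD !natrM; ring.
    exact/need_cast/(need_out _ D12)/out_split.
  exists rep => //; move: hrep; rewrite sum_nd.
  move: D12; case: D => [|[|[|//]]] // _; set M := \sum_v _ => hrep; lra.
(* With the opposite sign the arcs into [v0] get -2D, and the arcs out of it have a positive
   coefficient and are dropped. *)
- pose nd w : R := if w \in heavy then 0 else
    (2 * D)%:R * (E w v0)%:R - (o w)%:R - 2 * (kk w)%:R.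
  have sum_nd : \sum_w nd w = (2 * D)%:R * S1 - O - 2 * K.
    rewrite -count_in -count_o -count_kk !mulr_sumr -!sumrB [RHS]big_mkcond /=.
    by apply: eq_bigr => w _; rewrite /nd; case: (w \in heavy).
  have [||rep rs hrep] := @star_packing T Elight El_irr R D nd => //.
    move=> w; rewrite /nd; case: (boolP (w \in heavy)) => wA; first by constructor 1.
    have -> : (2 * D)%:R * (E w v0)%:R - (o w)%:R - 2 * (kk w)%:R =
        (2 * D * E w v0)%:R - (o w + 2 * kk w)%:R :> R.
      by rewrite !natrD !natrM; ring.
    exact/need_cast/(need_in D12)/out_split.
  exists rep => //; move: hrep; rewrite sum_nd.
  move: D12; case: D => [|[|[|//]]] // _; set M := \sum_v _ => hrep; lra.
Qed.
End Dominant.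
End Partition.

(** * The lower bound *)

Lemma judicious_relation (R : realType) (D : nat) (eps : R) :
  (0 < D <= 2)%N -> 0 < eps ->
  exists m0 : nat, forall (T : finType) (E : rel T),
    let e u w : R := (E u w)%:R in
    irreflexive E -> m0%:R <= wsize e -> (forall v, (D + 1 <= #|[pred w | E v w]|)%N) ->
    let B := (D%:R / (2 * (2 * D%:R + 1)) - eps) * wsize e in
    exists V : pred T, B <= wcross e V /\ B <= wcross e (predC V).
Proof.
move=> D12 eps0.
pose c : R := D%:R / (2 * (2 * D%:R + 1)).
have Dc : D = 1%N /\ c = 1 / 6 \/ D = 2%N /\ c = 1 / 5.
  have [DE|DE] : D = 1%N \/ D = 2%N by lia.
    by left; split=> //; rewrite /c DE; field.
  by right; split=> //; rewrite /c DE; field.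
pose ep := Num.min eps 1.
have ep0 : 0 < ep by rewrite /ep lt_min eps0 ltr01.
have ep1 : ep <= 1 by rewrite /ep ge_min lexx orbT.
have epe : ep <= eps by rewrite /ep ge_min lexx.
(* Each of [eta * m] and [m / L] becomes [ep / 8 * m]; [delta] is then what the variance bound for
   blocks allows. *)
pose eta := ep / 8; pose L := 8 / ep; pose delta := eta ^+ 3 / (4 * (1 + L)).
have eta0 : 0 < eta by rewrite divr_gt0.
have eta01 : 0 < eta <= 1 by rewrite eta0 /=; rewrite /eta; lra.
have L0 : 0 < L by rewrite divr_gt0.
have L1 : 0 < 1 + L by rewrite addr_gt0.
have delta0 : 0 < delta by apply: divr_gt0; [exact: exprn_gt0 | exact: mulr_gt0].
have deltaL : 2 * (1 + L) * delta = eta ^+ 3 / 2.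
  by rewrite /delta; move: (eta) (L) L1 => x y y1; field; rewrite gt_eqF.
have dL0 : 0 <= L * delta by rewrite mulr_ge0 // ltW.
(* Above this size the square of the number of heavy vertices, at most [4 / delta ^+ 2], is below
   [ep / 4 * m]. *)
pose C := 16 / (delta ^+ 2 * ep).
have C0 : 0 < C by apply: divr_gt0 => //; apply: mulr_gt0 => //; exact: exprn_gt0.
exists (Num.bound C) => T E e irrE; set m := wsize e => hm hout; rewrite -/c => B.
have Cm : C < m by apply: lt_le_trans hm; apply: archi_boundP; rewrite ltW.
have m0 : 0 < m := lt_trans C0 Cm.
pose A := heavy E delta.
have hA : #|A|%:R ^+ 2 <= ep / 4 * m.
  have hA1 := card_heavy m0 delta0.
  have : (#|A|%:R * delta) ^+ 2 <= 2 ^+ 2.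
    by apply: lerXn2r; rewrite ?nnegrE //; apply: mulr_ge0 => //; exact: ltW.
  rewrite exprMn -ler_pdivlMr ?exprn_gt0 // => /le_trans; apply.
  have -> : 2 ^+ 2 / delta ^+ 2 = ep / 4 * C.
    by rewrite /C; move: (delta) (ep) delta0 ep0 => x y x0 y0; field; rewrite !gt_eqF.
  by rewrite ler_pM2l ?divr_gt0 // ltW.
have mL : m / L = ep / 8 * m by rewrite /L; move: (ep) ep0 => y y0; field; rewrite gt_eqF.
have epm : ep * m <= eps * m by rewrite ler_pM2r.
have epm0 : 0 < ep * m by rewrite mulr_gt0.
have [sg [sg1 th0 cases]] := min_signed_sum A (excess e).
set theta := \sum_(v in A) _ in th0 cases.
(* The errors add up to (1/2 + 1/8 + 1/8) [ep * m]. *)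
have finish (X : R) : c * m - 2 * #|A|%:R ^+ 2 - m / L - eta * m <= X -> B <= X.
  apply: le_trans; rewrite /B mulrBl mL /eta; lra.
have D0 : c * m <= m / 5.
  rewrite mulrC ler_pM2l //; case: Dc => -[_ ->]; lra.
have A0 : 0 <= #|A|%:R ^+ 2 :> R by rewrite exprn_ge0.
have blocks (rep : T -> T) : star_rep (Elight E delta) rep ->
    (2 * D + 1)%:R * theta <= m + (2 * D + 1)%:R *
      \sum_v (mult (Elight E delta) v (rep v))%:R + 10 * #|A|%:R ^+ 2 ->
    exists V : pred T, B <= wcross e V /\ B <= wcross e (predC V).
  move=> rs hth.
  have [|V [hV1 hV2]] := block_partition irrE m0 delta0 sg1 rs eta01 L0.
    by rewrite deltaL.
  rewrite -/e -/m -/A -/theta ger0_norm // in hV1 hV2.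
  set M := \sum_v _ in hth hV1 hV2.
  (* [c] is a quarter of 1 - 1 / (2D + 1), and the heavy error has coefficient 10 / (4 (2D + 1)),
     which is below 1. *)
  have key : c * m - #|A|%:R ^+ 2 <= (m + M - theta) / 4.
    by move: hth; case: Dc => -[-> ->]; lra.
  by exists V; split; apply: finish; [move: hV1|move: hV2]; lra.
case: cases => [th00|[w wA hw]|[v vA hv]].
- apply: (blocks id).
    by split=> [v|v|u v] //; rewrite eqxx.
  rewrite th00 mulr0 big1 ?mulr0 ?addr0 => [|v _]; first lra.
  by rewrite /mult /Elight irrE.
- have [|V [hV1 hV2]] := biased_partition irrE m0 delta0 sg1 eta01 _ th0 wA hw.
    by lra.
  rewrite -/e -/m -/A in hV1 hV2.
  by exists V; split; apply: finish; [move: hV1|move: hV2]; rewrite mL; lra.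
- have [rep rs hrep] := dominant_packing irrE sg1 D12 hout vA hv.
  exact: (blocks rep).
Qed.

Lemma judicious_digraph (R : realType) (d : nat) (eps : R) : d = 2%N \/ d = 3%N ->
  0 < eps ->
  exists m0 : nat, forall D : digraph,
    (m0 <= #|edges D|)%N -> min_outdeg_ge D d ->
    exists V1 V2 : {set D}, bipartition V1 V2 /\
      ((d%:R - 1) / (2 * (2 * d%:R - 1)) - eps) * #|edges D|%:R
        <= (minn (edges_between V1 V2) (edges_between V2 V1))%:R.
Proof.
move=> d23 eps0.
have [k k12 dk] : exists2 k, (0 < k <= 2)%N & d = k.+1.
  by case: d23 => ->; [exists 1%N|exists 2%N].
have [m0 hm0] := judicious_relation k12 eps0.
exists m0 => D hm hout.
pose E : rel D := fun u w => (u, w) \in edges D.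
pose e u w : R := (E u w)%:R.
have irrE : irreflexive E by move=> v; apply/negbTE/edges_loopless.
have card_pairs (P : pred (D * D)) : #|[set p | P p]|%:R = \sum_u \sum_w (P (u, w))%:R :> R.
  rewrite pair_bigA /= -sum1_card natr_sum [LHS]big_mkcond /=; apply: eq_bigr => -[u w] _.
  by rewrite inE; case: (P _).
have sizeE : #|edges D|%:R = wsize e.
  have -> : edges D = [set p | p \in edges D] by apply/setP => p; rewrite inE.
  by rewrite card_pairs.
have crossE (V : pred D) : (edges_between [set v | V v] [set v | ~~ V v])%:R = wcross e V.
  have -> : edges_between [set v | V v] [set v | ~~ V v] =
      #|[set p | (p \in edges D) && (V p.1 && ~~ V p.2)]|.
    by apply: eq_card => p; rewrite !inE.
  rewrite card_pairs; apply: eq_bigr => u _; apply: eq_bigr => w _.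
  by rewrite /e /E; case: (_ \in edges D); case: (V u); case: (V w); rewrite /= ?mulr1 ?mulr0.
have [||V [hV1 hV2]] := hm0 D E irrE.
- by rewrite -sizeE ler_nat.
- move=> v; have := hout v; rewrite /outdeg dk addn1 => /leq_trans; apply.
  by apply: subset_leq_card; apply/fintype.subsetP => w; rewrite !inE.
exists [set v | V v], [set v | ~~ V v]; split.
  split; first by apply/setP => v; rewrite !inE orbN.
  by rewrite -setI_eq0; apply/eqP/setP => v; rewrite !inE andbN.
have -> : (d%:R - 1) / (2 * (2 * d%:R - 1)) = k%:R / (2 * (2 * k%:R + 1)) :> R.
  by rewrite dk -natr1; congr (_ / (2 * _)); ring.
have c2 : (edges_between [set v | ~~ V v] [set v | V v])%:R = wcross e (predC V).
  rewrite -crossE; congr (edges_between _ _)%:R; apply/setP => v; rewrite !inE //=.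
  by rewrite negbK.
rewrite sizeE natr_min le_min; rewrite crossE c2; by apply/andP.
Qed.

(** * The upper bound *)

Lemma sum_option (T : finType) (F : option T -> nat) :
  (\sum_x F x = F None + \sum_t F (Some t))%N.
Proof.
rewrite (bigD1 None) //=; congr addn.
rewrite (reindex_omap Some id) => [|[]] //=.
by apply: eq_bigl => t; rewrite eqxx.
Qed.

Lemma sum_pair (I J : finType) (F : I * J -> nat) :
  (\sum_x F x = \sum_i \sum_j F (i, j))%N.
Proof. by rewrite pair_bigA; apply: eq_bigr => -[]. Qed.

Section UpperBound.
Variables (K : finType) (tour : rel K) (q D t : nat).
Hypothesis tour_irr : irreflexive tour.
Hypothesis K_card : #|K| = q.
Hypothesis Dq : (D < q)%N.
Hypothesis tour_out : forall a, (\sum_b tour a b)%N = D.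
Hypothesis tour_cut : forall f : K -> bool, (\sum_a \sum_b [&& tour a b, f a & ~~ f b] <= t)%N.

Variable N : nat.

(* Disjoint copies of [tour], all of whose vertices send an arc to the hub
   [None]; the hub sends arcs to the first copy only, to have outdegree [q]. *)
Definition hub_rel (u v : option ('I_N.+1 * K)) : bool :=
  match u, v with
  | Some (i, a), Some (j, b) => (i == j) && tour a b
  | Some _, None => true
  | None, Some (i, _) => i == ord0
  | None, None => false
  end.

Let hub_edges := [set p | hub_rel p.1 p.2].

Lemma hub_loopless v : (v, v) \notin hub_edges.
Proof. by rewrite inE; case: v => [[i a]|] //=; rewrite tour_irr andbF. Qed.

Definition hub_digraph := Digraph hub_loopless.

Let card_pairs (T : finType) (P : pred (T * T)) :
  #|[set p | P p]| = (\sum_u \sum_w P (u, w))%N.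
Proof.
rewrite -(sum_pair (fun p => nat_of_bool (P p))) -sum1_card [LHS]big_mkcond /=; apply: eq_bigr => -[u w] _.
by rewrite inE; case: (P _).
Qed.

Let card_indicator (T : finType) (P : pred T) : #|[set p | P p]| = (\sum_u P u)%N.
Proof.
rewrite -sum1_card [LHS]big_mkcond /=; apply: eq_bigr => u _.
by rewrite inE; case: (P _).
Qed.

Let copy_out (i : 'I_N.+1) a : (\sum_(x : 'I_N.+1 * K) hub_rel (Some (i, a)) (Some x))%N = D.
Proof.
rewrite sum_pair /=.
rewrite (bigD1 i) //= [X in (_ + X)%N]big1 ?addn0 => [|j]; last first.
  by move=> ji; apply: big1 => b _; rewrite /= [i == j]eq_sym (negbTE ji).
by rewrite -[RHS](tour_out a); apply: eq_bigr => b _; rewrite eqxx.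
Qed.

Lemma hub_outdeg : min_outdeg_ge hub_digraph D.+1.
Proof.
move=> v; rewrite /outdeg card_indicator sum_option.
case: v => [[i a]|].
  under eq_bigr do rewrite inE.
  by rewrite copy_out inE.
rewrite sum_pair.
rewrite (bigD1 ord0) //=; under eq_bigr do rewrite inE /=.
by rewrite sum1_card K_card; apply: leq_trans Dq _; rewrite addnCA leq_addr.
Qed.

Lemma hub_size : (N.+1 * (q * D.+1) <= #|edges hub_digraph|)%N.
Proof.
rewrite card_pairs sum_option; apply: leq_trans (leq_addl _ _).
have -> : (N.+1 * (q * D.+1) = \sum_(x : 'I_N.+1 * K) D.+1)%N.
  by rewrite sum_nat_const card_prod card_ord K_card mulnA.
by apply: leq_sum => -[i a] _; rewrite sum_option copy_out.
Qed.

(** Arcs into the hub stay on its side. Those that leave are at most [q] arcs of the hub and, in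
    each copy, a cut of the tournament. *)
Let hub_out_bound (X Y : {set hub_digraph}) : [disjoint X & Y] -> X :|: Y = finset.setT ->
  None \in X -> (edges_between X Y <= q + N.+1 * t)%N.
Proof.
move=> dXY cXY hX.
have YE v : (v \in Y) = (v \notin X).
  have : v \in X :|: Y by rewrite cXY finset.in_setT.
  rewrite inE; case: (boolP (v \in X)) => //= vX _.
  by apply/negbTE; rewrite (disjointFr dXY).
rewrite /edges_between card_pairs sum_option.
have hub_part : (\sum_(w : option ('I_N.+1 * K))
    ((None, w) \in hub_edges) && ((None \in X) && (w \in Y)) <= q)%N.
  rewrite sum_option inE add0n sum_pair (bigD1 ord0) //= [X in (_ + X)%N]big1 ?addn0.
    rewrite -K_card -sum1_card; apply: leq_sum => a _; exact: leq_b1.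
  by move=> i /negbTE i0; apply: big1 => a _; rewrite inE /= i0.
apply: leq_add hub_part _; rewrite sum_pair.
have -> : (N.+1 * t = \sum_(i < N.+1) t)%N by rewrite sum_nat_const card_ord.
apply: leq_sum => i _; apply: leq_trans (tour_cut (fun a => Some (i, a) \in X)).
apply: leq_sum => a _; rewrite sum_option inE /= YE hX andbF add0n sum_pair.
rewrite (bigD1 i) //= [X in (_ + X)%N]big1 ?addn0 => [|j]; last first.
  by move=> ji; apply: big1 => b _; rewrite inE /= [i == j]eq_sym (negbTE ji).
by apply: leq_sum => b _; rewrite inE /= eqxx YE.
Qed.

Lemma hub_bound (X Y : {set hub_digraph}) : bipartition X Y ->
  (minn (edges_between X Y) (edges_between Y X) <= q + N.+1 * t)%N.
Proof.
move=> [cXY dXY]; rewrite geq_min.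
have : None \in X :|: Y by rewrite cXY inE.
rewrite inE => /orP[hX|hY]; first by rewrite hub_out_bound.
by rewrite [X in _ || X]hub_out_bound ?orbT // 1?disjoint_sym // finset.setUC.
Qed.

End UpperBound.

(** In the hub construction each copy has [#|K| * D.+1] arcs and contributes at most [t] to the cut;
    the arcs of the hub are negligible for many copies. *)
Lemma admissible_le (R : realType) (K : finType) (tour : rel K) (D t : nat) (c : R) :
  irreflexive tour -> (D < #|K|)%N -> (forall a, (\sum_b tour a b)%N = D) ->
  (forall f : K -> bool, (\sum_a \sum_b [&& tour a b, f a & ~~ f b] <= t)%N) ->
  admissible_const D.+1 c -> c * (#|K| * D.+1)%:R <= t%:R.
Proof.
move=> tirr DK tout tcut [m0 hm0]; rewrite leNgt; apply/negP => lt_tc.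
pose q := #|K|; pose s := (q * D.+1)%N.
have s0 : (0 < s)%N by rewrite muln_gt0 andbT (leq_ltn_trans (leq0n D)).
have c0 : 0 < c.
  by have := le_lt_trans (ler0n R t) lt_tc; rewrite pmulr_lgt0 // ltr0n.
pose g : R := c * s%:R - t%:R.
have g0 : 0 < g by rewrite subr_gt0.
(* Enough copies to reach [m0] arcs and to make the total gap, [g] per copy, exceed the [q] arcs of
   the hub. *)
pose N := maxn m0 (Num.bound (q%:R / g)).
have [||X [Y [bXY hXY]]] := hm0 (hub_digraph tirr N).
- apply: leq_trans (hub_size tirr (erefl q) tout N); rewrite -/s.
  by apply: (@leq_trans N.+1); [rewrite leqW // leq_maxl | rewrite leq_pmulr].
- exact: hub_outdeg.
have hN : q%:R < N.+1%:R * g.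
  rewrite -ltr_pdivrMr //; apply: (@lt_le_trans _ _ (Num.bound (q%:R / g))%:R).
    by apply: archi_boundP; rewrite divr_ge0 // ltW.
  by rewrite ler_nat leqW // leq_maxr.
have h1 : c * (N.+1 * s)%:R <= c * #|edges (hub_digraph tirr N)|%:R.
  by rewrite ler_pM2l // ler_nat; apply: hub_size.
have h2 := hub_bound (erefl q) tcut bXY; rewrite -(ler_nat R) in h2.
have := le_trans h1 (le_trans hXY h2); rewrite natrD !natrM -/s.
by move: hN; rewrite /g /s natrM; lra.
Qed.

(** The directed triangle and, below it, the circulant with steps 1 and 2 modulo 5; adding the
    modulus first avoids truncated subtraction. *)
Definition tour3 : rel 'I_3 := fun a b => ((b + 3 - a) %% 3 == 1)%N.
Definition tour5 : rel 'I_5 := fun a b => (0 < (b + 5 - a) %% 5 <= 2)%N.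

(** In a regular tournament on q vertices, k (q - k) / 2 arcs leave a set of size k: at most 1 for q
    = 3 and 3 for q = 5. The proofs run through all [f]. *)
Lemma tour3_cut (f : 'I_3 -> bool) :
  (\sum_a \sum_b [&& tour3 a b, f a & ~~ f b] <= 1)%N.
Proof.
rewrite !big_ord_recl !big_ord0 /tour3 /=.
do 3!case: (f _) => //=.
Qed.

Lemma tour5_cut (f : 'I_5 -> bool) :
  (\sum_a \sum_b [&& tour5 a b, f a & ~~ f b] <= 3)%N.
Proof.
rewrite !big_ord_recl !big_ord0 /tour5 /=.
do 5!case: (f _) => //=.
Qed.

(** The hypotheses also supply the nonemptiness and the upper bound without which [sup] would take
    its default value. *)
Lemma opt_const_eq (R : realType) (d : nat) (b : R) :
  (forall eps, 0 < eps -> admissible_const d (b - eps)) ->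
  (forall c, admissible_const d c -> c <= b) -> opt_const R d = b.
Proof.
move=> low up; apply/eqP; rewrite eq_le; apply/andP; split.
  by apply: ge_sup; [exists (b - 1); apply: low | move=> c; apply: up].
apply/ler_addgt0Pr => eps eps0; rewrite -lerBlDr; apply: ub_le_sup.
  by exists b => c; apply: up.
exact: low.
Qed.

Theorem theorem1p1 (R : realType) :
  (forall d : nat, d = 2%N \/ d = 3%N ->
    forall eps : R, 0 < eps ->
    exists m0 : nat, forall D : digraph,
      (m0 <= #|edges D|)%N -> min_outdeg_ge D d ->
      exists V1 V2 : {set D}, bipartition V1 V2 /\
        ((d%:R - 1) / (2 * (2 * d%:R - 1)) - eps) * #|edges D|%:R
          <= (minn (edges_between V1 V2) (edges_between V2 V1))%:R) /\
  opt_const R 2 = 1 / 6 /\ opt_const R 3 = 1 / 5.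
Proof.
have low := fun d d23 (eps : R) => @judicious_digraph R d eps d23.
split; first exact: low.
split; apply: opt_const_eq.
- move=> eps eps0; have := low 2%N (or_introl erefl) eps eps0.
  have -> : (2%:R - 1) / (2 * (2 * 2%:R - 1)) = 1 / 6 :> R by field.
  by [].
- move=> c /(@admissible_le _ _ tour3 1 1 c) h.
  have : c * (#|'I_3| * 2)%:R <= 1%:R.
    apply: h; [| | |exact: tour3_cut].
    + by case=> [[|[|[|]]]].
    + by rewrite card_ord.
    + by case=> [[|[|[|]]]] // i; rewrite !big_ord_recl big_ord0.
  by rewrite card_ord; lra.
- move=> eps eps0; have := low 3%N (or_intror erefl) eps eps0.
  have -> : (3%:R - 1) / (2 * (2 * 3%:R - 1)) = 1 / 5 :> R by field.
  by [].
- move=> c /(@admissible_le _ _ tour5 2 3 c) h.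
  have : c * (#|'I_5| * 3)%:R <= 3%:R.
    apply: h; [| | |exact: tour5_cut].
    + by case=> [[|[|[|[|[|]]]]]].
    + by rewrite card_ord.
    + by case=> [[|[|[|[|[|]]]]]] // i; rewrite !big_ord_recl big_ord0.
  by rewrite card_ord; lra.
Qed.
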